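(* The function $\alpha$ is nowhere differentiable if and only if there is a periodic point $x$ of $f$ such that $$\sum_{i=0}^{p-1}\phi\circ f^i(x)\neq 0,$$ where $p$ is the period of $x$.
   Context: Identify $\mathbb{S}^1$ with $\mathbb{R}/\mathbb{Z}$ via $t\mapsto(\cos 2\pi t,\sin 2\pi t)$; functions on $\mathbb{S}^1$ are identified with $1$-periodic functions on $\mathbb{R}$. Fix $\epsilon\in(0,1)$; $C^{k+\epsilon}$ means $C^k$ with $\epsilon$-Hölder $k$-th derivative. Let $f:\mathbb{S}^1\to\mathbb{S}^1$ be a $C^{2+\epsilon}$ expanding map, i.e. there is $\lambda>1$ with $|Df(x)|>\lambda$ for every $x$, and let $v:\mathbb{S}^1\to\mathbb{R}$ be a $C^{1+\epsilon}$ function. The generalized Weierstrass function $\alpha:\mathbb{S}^1\to\mathbb{R}$ is $$\alpha(y)=-\sum_{n=1}^{\infty}\frac{v(f^{n-1}(y))}{Df^n(y)},$$ where $f^n$ is the $n$-th iterate of $f$; it is the unique bounded solution of $v(x)=\alpha(f(x))-Df(x)\alpha(x)$. Let $$\phi(x)=-\left(\frac{v'(x)+\alpha(x)D^2f(x)}{Df(x)}\right).$$ *)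

(* Defs.v *)
From mathcomp Require Import all_boot all_order all_algebra.
From mathcomp Require Import all_classical all_reals all_analysis.
From mathcomp Require Import generic_quotient ring_quotient.
Import Order.TTheory GRing.Theory Num.Theory.
Import numFieldNormedType.Exports.

Set Implicit Arguments.
Unset Strict Implicit.
Unset Printing Implicit Defensive.

Local Open Scope ring_scope.
Local Open Scope quotient_scope.

Definition int_zmodClosed (R : realType) : zmodClosed R :=
  GRing.ZmodClosed.clone R (@Num.int_num_subdef R) _.

(* The circle R/Z; see circle_projP. *)
Definition circle (R : realType) : Type := Quotient.quot (int_zmodClosed R).

Definition circle_proj (R : realType) (t : R) : circle R :=
  \pi_(Quotient.quot (int_zmodClosed R)) t.

Definition circle_repr (R : realType) (x : circle R) : R :=
  repr (x : Quotient.quot (int_zmodClosed R)).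

Lemma circle_reprK (R : realType) (x : circle R) :
  circle_proj (circle_repr x) = x.
Proof. exact: reprK. Qed.

Lemma circle_projP (R : realType) (s t : R) :
  circle_proj s = circle_proj t <-> s - t \is a Num.int.
Proof.
rewrite [s - t \is a Num.int](Quotient.idealrBE (int_zmodClosed R)).
by split=> /eqP.
Qed.

(* C^{k+eps} on the line.  The Hölder bound is global; for a 1-periodic k-th
   derivative, which is the only case used, this is the Hölder condition on the
   circle.  It also gives the continuity of the k-th derivative. *)
Definition C_holder (R : realType) (k : nat) (eps : R) (g : R -> R) : Prop :=
  (forall i (t : R), (i < k)%N -> derivable (derive1n i g) t 1) /\
  (exists C : R, forall s t : R,
     `|derive1n k g s - derive1n k g t| <= C * `|s - t| `^ eps).

(* A circle map is of class C^{k+eps} when it has a lift of that class.  Two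
   continuous lifts differ by an integer constant, so they have the same
   derivatives. *)
Definition is_lift (R : realType) (f : circle R -> circle R) (F : R -> R) :=
  forall t, circle_proj (F t) = f (circle_proj t).

(* k-th derivative at a point of the circle.  G is either a lift of a circle map
   or the 1-periodic function u \o circle_proj for u : circle R -> R.  For such
   G of class C^k with k >= 1 the value does not depend on the representative. *)
Definition circle_derive (R : realType) (k : nat) (G : R -> R) (x : circle R) :
  R := derive1n k G (circle_repr x).

Definition circle_derivable (R : realType) (u : circle R -> R) (x : circle R) :
  Prop := derivable (u \o @circle_proj R) (circle_repr x) 1.

Definition expanding (R : realType) (F : R -> R) : Prop :=
  exists2 lambda : R, 1 < lambda & forall x, lambda < `|circle_derive 1 F x|.

(* iter n F is a lift of iter n f, so the denominators are D(f^n)(y). *)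
Definition alpha (R : realType) (f : circle R -> circle R) (F : R -> R)
    (v : circle R -> R) (y : circle R) : R :=
  - limn (fun N => \sum_(1 <= n < N)
      v (iter n.-1 f y) / circle_derive 1 (iter n F) y).

Definition phi (R : realType) (f : circle R -> circle R) (F : R -> R)
    (v : circle R -> R) (x : circle R) : R :=
  - ((circle_derive 1 (v \o @circle_proj R) x
      + alpha f F v x * circle_derive 2 F x) / circle_derive 1 F x).

Definition is_period (T : Type) (f : T -> T) (x : T) (p : nat) : Prop :=
  [/\ (0 < p)%N, iter p f x = x &
      forall q, (0 < q < p)%N -> iter q f x <> x].

(* Main.v *)
Require Import Defs.
From mathcomp Require Import all_boot all_order all_algebra.
From mathcomp Require Import all_classical all_reals all_analysis.
From mathcomp Require Import ring lra.
Import Order.TTheory GRing.Theory Num.Theory.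
Import numFieldNormedType.Exports.

Local Open Scope ring_scope.

(** Everything happens on the line: the lift [F] is a bijection of [R] that
    expands distances by at least [lambda > 1], and [A], the 1-periodic function
    given by [alpha], solves [A (F t) = V t + F1 t * A t], where [F1], [F2], [V1]
    are the derivatives [F'], [F''], [V'].

    Write [slope a b] for the difference quotient of [A] between [a] and [b].
    Subtracting the equation at two nearby points gives
      [slope (F a) (F b) = slope a b - Phi a + O(|a - b| ^ g)],
    so [Phi] is exactly the amount that [F] removes from an infinitesimal slope.
    Backward orbits contract geometrically, hence the errors add up to a
    multiple of the last one: with [S_n] the Birkhoff sums of [Phi],
      [slope (F^n a) (F^n b) = slope a b - S_n a + O(|F^n a - F^n b| ^ g)]
    uniformly in [n] (slope_iter).  The two implications read this relation in
    opposite directions.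

    If [A] is differentiable at one point [y], the slopes between points very
    close to [y], seen at a scale comparable with their distance to [y], are
    almost equal.  Bounded distortion of the iterates carries this to a whole
    period around [F^n y]: the slope of a pair [(p, q)] and that of
    [(p, p + 1)], which is 0 by periodicity, differ by a bounded amount.  So [A]
    is Lipschitz (slope_bounded_of_derivable), and then the relation bounds
    [S_n] uniformly.  At a periodic point [S_(n p) = n * S_p], so [S_p = 0].

    Conversely, let all periodic sums vanish.  An orbit segment that nearly
    closes up modulo 1 is shadowed by a periodic one (closing), so its Birkhoff
    sum is small (birkhoff_recurrence).  All Birkhoff sums are thus bounded, and
    [A] is Lipschitz.  Fix [t] and let [M] be the upper limit of the slopes as
    both points tend to [t].  Take a pair [(z, w)] very close to [t] whose slope
    is nearly [M], and expand it by [F^n] until its image covers a translate of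
    a small ball around [t].  Since no pair near [t] has slope much above [M]
    and the slope of [(z, w)] is an average of those of its subintervals, every
    subinterval of comparable size has slope nearly [M].  Those that [F^n] maps
    into the translated ball start and end near [t] modulo 1, so their slopes
    are transported almost unchanged: every pair in the ball has slope close to
    [M] (slope_lower_bound), and [A] is differentiable at [t]. *)

(** * Real functions and their slopes *)

Lemma ler_of_eq {R : realType} (x y : R) : x = y -> x <= y.
Proof. by move=> ->. Qed.

Lemma ler_powR_base {R : realType} (r a b : R) :
  0 <= r -> 0 <= a -> a <= b -> a `^ r <= b `^ r.
Proof.
move=> r0 a0 ab.
by have := ge0_ler_powR r0; apply => //; rewrite nnegrE// (le_trans a0).
Qed.

Lemma derivable_first_order {R : realType} (A : R -> R) (y : R) :
  derivable A y 1 -> exists l : R, forall e : R, 0 < e ->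
    exists2 d : R, 0 < d & forall x, `|x - y| < d ->
      `|A x - A y - l * (x - y)| <= e * `|x - y|.
Proof.
move=> /cvg_ex[l Hl]; exists l => e e0.
move/cvgrPdist_le: Hl => /(_ e e0) /nbhs_ballP[d /= d0 Hd].
exists d => // x xd.
have [->|xy] := eqVneq x y; first by rewrite !subrr mulr0 subrr normr0 mulr0.
have xy0 : x - y != 0 by rewrite subr_eq0.
have := Hd (x - y); rewrite /ball/= sub0r normrN => /(_ xd xy0).
rewrite /GRing.scale/= mulr1 subrK => h.
rewrite -[X in X - l * _](divfK xy0) -mulrBl normrM ler_wpM2r//.
by rewrite distrC mulrC.
Qed.

Lemma derivable_of_slope {R : realType} (A : R -> R) (y l : R) :
  (forall e : R, 0 < e -> exists2 d : R, 0 < d & forall x, x != y -> `|x - y| < d ->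
      `|(A x - A y) / (x - y) - l| <= e) -> derivable A y 1.
Proof.
move=> H; apply/cvg_ex; exists l; apply/cvgrPdist_le => e e0.
have [d d0 Hd] := H e e0.
apply/nbhs_ballP; exists d => //= h; rewrite /ball/= sub0r normrN => hd h0.
have := Hd (h + y); rewrite addrK.
rewrite -subr_eq0 addrK => /(_ h0 hd).
by rewrite /GRing.scale/= mulr1 distrC mulrC.
Qed.

Lemma int_translate_near {R : realType} (t u : R) :
  exists2 k : R, k \is a Num.int & `|u + k - t| <= 1.
Proof.
exists (Num.floor (t - u))%:~R; first exact: intr_int.
have := floor_le (t - u); have := floorD1_gt (t - u).
rewrite intrD; set k := (_%:~R); move=> h1 h2.
rewrite ler_norml; apply/andP; split; lra.
Qed.

Lemma contraction_fixpoint_line {R : realType} (q : R) (T : R -> R) :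
  0 <= q -> q < 1 -> (forall a b, `|T a - T b| <= q * `|a - b|) ->
  exists x, T x = x.
Proof.
move=> q0 q1 HT.
have ctr : @is_contraction R R R setT setT [the {fun setT >-> setT} of totalfun T].
  exists (NngNum q0); split=> //= -[a b] _ /=; exact: HT.
have [||p _ pE] := banach_fixed_point ctr; [exact: closedT | by exists 0 |].
by exists p; rewrite [RHS]pE.
Qed.

(** The equality [|a - c| + |c - b| = |a - b|] says that [c] lies between [a] and
    [b] whatever their order, so that it makes sense for orientation reversing
    maps as well. *)
Lemma between_midpoint {R : realType} (a b c : R) :
  `|c - (a + b) / 2| <= `|a - b| / 2 ->
  `|a - c| + `|c - b| = `|a - b|.
Proof.
wlog ab : a b / a <= b => [H|].
  have [/H//|/ltW ba] := leP a b.
  rewrite [a + b]addrC [`|a - b|]distrC => h; rewrite -(H _ _ ba h).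
  by rewrite addrC [`|c - b|]distrC [`|a - c|]distrC.
rewrite [`|a - b|]distrC (ger0_norm (x := b - a)) ?subr_ge0// ler_norml => /andP[h1 h2].
by rewrite ler0_norm ?ler0_norm; lra.
Qed.

Lemma between_le {R : realType} (a b c : R) :
  `|a - c| + `|c - b| = `|a - b| -> a <= b -> a <= c <= b.
Proof.
move=> + ab; rewrite [`|a - b|]distrC (ger0_norm (x := b - a)) ?subr_ge0//.
have h1 : c - a <= `|a - c| by rewrite distrC ler_norm.
have h2 : b - c <= `|c - b| by rewrite distrC ler_norm.
have h3 := ler_norm (a - c); have h4 := ler_norm (c - b) => h.
by apply/andP; split; lra.
Qed.

Lemma between_dist {R : realType} (a b c : R) :
  `|a - c| + `|c - b| = `|a - b| ->
  `|c - a| <= `|b - a| /\ `|b - c| <= `|b - a|.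
Proof.
by move=> h; rewrite (distrC c) !(distrC b) -h lerDl lerDr !normr_ge0.
Qed.

(** [M] is the upper limit of [D] at the diagonal point [(t, t)], taken as the
    infimum of the upper bounds of [D] on punctured squares around it. *)
Lemma local_limsup {R : realType} (D : R -> R -> R) (t L : R) :
  (forall a b, a != b -> `|a - b| < 1 -> `|D a b| <= L) ->
  exists M, (forall e, 0 < e -> exists2 r, 0 < r & forall a b, a != b ->
               `|a - t| <= r -> `|b - t| <= r -> D a b <= M + e) /\
            (forall e r, 0 < e -> 0 < r -> exists a b, [/\ a != b,
               `|a - t| <= r, `|b - t| <= r & M - e <= D a b]).
Proof.
move=> HL.
pose X := [set m | exists2 r, 0 < r & forall a b, a != b ->
               `|a - t| <= r -> `|b - t| <= r -> D a b <= m]%classic.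
have XL : X L.
  exists (1/3); first by lra.
  move=> a b ab at1 bt1; have := HL a b ab; rewrite ler_norml => h.
  suff /h /andP[] : `|a - b| < 1 by [].
  apply: le_lt_trans (ler_distD t _ _) _; rewrite (distrC t b); lra.
have Xlb : lbound X (- L).
  move=> m [r r0 Hr].
  (* Some pair of points must be exhibited to see that [m] is not too small. *)
  pose s := Num.min r (1/2).
  have s0 : 0 < s by rewrite /s lt_min r0 /=; lra.
  have sr : s <= r by rewrite /s ge_min lexx.
  have s1 : s < 1 by rewrite /s gt_min; apply/orP; right; lra.
  have tn : t + s != t by rewrite -subr_eq0 addrAC subrr add0r gt_eqF.
  have ts : `|t + s - t| = s by rewrite addrAC subrr add0r gtr0_norm.
  have h1 := Hr _ _ tn; have h2 := HL _ _ tn.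
  rewrite ts subrr normr0 in h1 h2.
  have := h2 s1; rewrite ler_norml => /andP[h3 _].
  by apply: le_trans h3 _; apply: h1 => //; apply: ltW.
have Xinf : has_inf X by split; [exists L | exists (- L)].
exists (inf X); split.
  move=> e e0; have [m [r r0 Hr] me] := inf_adherent e0 Xinf.
  exists r => // a b ab ar br; apply: le_trans (Hr a b ab ar br) _; exact: ltW.
move=> e r e0 r0; apply: contrapT => H.
have : X (inf X - e).
  exists r => // a b ab ar br; apply/ltW; rewrite ltNge; apply/negP => h.
  by apply: H; exists a, b.
move=> /(ge_inf (proj2 Xinf)); lra.
Qed.

Lemma mean_value {R : realType} (h dh : R -> R) (a b : R) :
  (forall t : R, is_derive t (1 : R) h (dh t)) ->
  exists2 c, `|a - c| + `|c - b| = `|a - b| & h b - h a = dh c * (b - a).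
Proof.
move=> hd.
have main x y : x <= y -> exists2 c, x <= c <= y & h y - h x = dh c * (y - x).
  move=> xy.
  have [|c] := @MVT_segment R h dh x y xy (fun t _ => hd t).
    by apply: derivable_within_continuous => t _; exact: ex_derive.
  by rewrite in_itv /=; exists c.
have [ab|/ltW ba] := leP a b.
  have [c /andP[ac cb] E] := main a b ab; exists c => //.
  by rewrite !ler0_norm; lra.
have [c /andP[bc ca] E] := main b a ba; exists c.
  by rewrite !ger0_norm; lra.
by rewrite -(opprB (h a)) E; ring.
Qed.

Lemma norm_lim_le {R : realType} (u : nat -> R) (l B : R) :
  (u n @[n --> \oo] --> l)%classic -> (forall n, `|u n| <= B) -> `|l| <= B.
Proof.
move=> ul uB.
have nl : (`|u n| @[n --> \oo] --> `|l|)%classic by apply: cvg_norm.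
rewrite -(cvg_lim _ nl)//; apply: limr_le; first by apply/cvg_ex; exists `|l|.
exact: nearW.
Qed.

(** The difference [h (t + k) - h t] is continuous with integer values, hence
    locally constant, and its derivative vanishes. *)
Lemma derivative_periodic {R : realType} (h dh : R -> R) :
  (forall t : R, is_derive t (1 : R) h (dh t)) ->
  (forall t k, k \is a Num.int -> h (t + k) - h t \is a Num.int) ->
  forall t k, k \is a Num.int -> dh (t + k) = dh t.
Proof.
move=> hd hi t k ki.
have cont x : {for x, continuous h}.
  by apply: differentiable_continuous; apply/derivable1_diffP; exact: ex_derive.
pose m := h (t + k) - h t.
have near_const : \forall s \near t, h (s + k) - m = h s.
  have c1 : {for t, continuous (fun s => h (s + k) - h s)}.
    apply: continuousB => //; apply: (@continuous_comp _ _ _ (fun s => s + k)) => //.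
    by apply: continuousD; [exact: cvg_id | exact: cvg_cst].
  have /cvgrPdist_lt/(_ 1 ltr01) := c1; apply: filterS => s hs.
  have int : m - (h (s + k) - h s) \is a Num.int by rewrite rpredB// hi.
  suff : m - (h (s + k) - h s) = 0 by rewrite /m; lra.
  apply/eqP; apply: contraTT hs => ne0; rewrite -leNgt.
  exact: norm_intr_ge1.
have dE x : 'D_1 h x = dh x by exact: derive_val.
rewrite -!dE -(@near_eq_derive R R R (fun s => h (s + k) - m) h t 1 near_const).
have -> : 'D_1 (fun s => h (s + k) - m) t = 'D_1 (fun s => h (s + k)) t.
  rewrite /derive.
  apply: (congr1 (fun q : R -> R => lim (q x @[x --> 0^'])%classic)).
  apply/funext => s /=.
  by congr (_ *: _); ring.
rewrite /derive.
apply: (congr1 (fun q : R -> R => lim (q x @[x --> 0^'])%classic)).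
apply/funext => s /=.
by rewrite addrA.
Qed.

Lemma lipschitz_of_derive_bound {R : realType} (h dh : R -> R) (M : R) :
  (forall t : R, is_derive t (1 : R) h (dh t)) -> (forall t, `|dh t| <= M) ->
  forall s t, `|h s - h t| <= M * `|s - t|.
Proof.
move=> hd hM s t; have [c _ ->] := mean_value h dh t s hd.
by rewrite normrM ler_wpM2r.
Qed.

Lemma is_derive_continuous {R : realType} (h dh : R -> R) :
  (forall t : R, is_derive t (1 : R) h (dh t)) -> continuous h.
Proof.
move=> hd x; apply: differentiable_continuous; apply/derivable1_diffP.
exact: ex_derive.
Qed.

(** * Bounded Hoelder functions *)

Definition bholder {R : realType} (g : R) (h : R -> R) : Prop :=
  exists2 C, 0 <= C & (forall t, `|h t| <= C) /\
    (forall s t, `|h s - h t| <= C * `|s - t| `^ g).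

(** At distance more than 1 the bound on [h] itself gives the inequality. *)
Lemma bholder_weaken {R : realType} (g e : R) (h : R -> R) :
  0 < g -> g <= e -> bholder e h -> bholder g h.
Proof.
move=> g0 ge [C C0 [hC hH]]; exists (2 * C); first by rewrite mulr_ge0.
split=> [t|s t]; first by apply: le_trans (hC t) _; rewrite ler_peMl// ler1n.
have [st|st] := leP `|s - t| 1.
  apply: le_trans (hH s t) _.
  apply: (@le_trans _ _ (C * `|s - t| `^ g)).
    apply: ler_wpM2l => //.
    have [->|st0] := eqVneq `|s - t| 0.
      by rewrite !powR0// gt_eqF// (lt_le_trans g0).
    by apply: ger_powR => //; rewrite lt_neqAle eq_sym st0 normr_ge0.
  by apply: ler_wpM2r; [exact: powR_ge0 | rewrite ler_peMl// ler1n].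
apply: le_trans (ler_normB _ _) _; apply: le_trans (lerD (hC s) (hC t)) _.
have := @ler_powR_base R g 1 `|s - t| (ltW g0) ler01 (ltW st); rewrite powR1 => h1.
have -> : C + C = 2 * C by ring.
by rewrite ler_peMr// mulr_ge0.
Qed.

(** The two factors may be evaluated at different points: this is the form in
    which the intermediate points of the mean value theorem appear. *)
Lemma bholder_product_near {R : realType} (g : R) (h i : R -> R) :
  0 <= g -> bholder g h -> bholder g i ->
  exists2 C, 0 <= C & forall a c c' d, `|c - a| <= d -> `|c' - a| <= d ->
    `|h c * i c' - h a * i a| <= C * d `^ g.
Proof.
move=> g0 [C C0 [hC hH]] [D D0 [iD iH]]; exists (2 * (C * D)); first by rewrite !mulr_ge0.
move=> a c c' d ca c'a.
have -> : h c * i c' - h a * i a = (h c - h a) * i c' + h a * (i c' - i a) by ring.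
apply: le_trans (ler_normD _ _) _; rewrite !normrM.
have hd : `|h c - h a| <= C * d `^ g.
  apply: le_trans (hH _ _) _; apply: ler_wpM2l => //; exact: ler_powR_base.
have id : `|i c' - i a| <= D * d `^ g.
  apply: le_trans (iH _ _) _; apply: ler_wpM2l => //; exact: ler_powR_base.
have h1 : `|h c - h a| * `|i c'| <= C * d `^ g * D by apply: ler_pM.
have h2 : `|h a| * `|i c' - i a| <= C * (D * d `^ g) by apply: ler_pM.
by apply: le_trans (lerD h1 h2) _; apply: ler_of_eq; ring.
Qed.

Lemma bholderM {R : realType} (g : R) (h i : R -> R) :
  0 <= g -> bholder g h -> bholder g i -> bholder g (fun t => h t * i t).
Proof.
move=> g0 hb ib; have [E E0 HE] := bholder_product_near g h i g0 hb ib.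
move: hb ib => [C C0 [hC _]] [D D0 [iD _]].
exists (C * D + E); first by rewrite addr_ge0// mulr_ge0.
split=> [t|s t].
  rewrite normrM; apply: (@le_trans _ _ (C * D)); first exact: ler_pM.
  by rewrite lerDl.
apply: le_trans (HE t s s _ (lexx _) (lexx _)) _.
by apply: ler_wpM2r; [exact: powR_ge0 | rewrite lerDr mulr_ge0].
Qed.

Lemma bholderD {R : realType} (g : R) (h i : R -> R) :
  bholder g h -> bholder g i -> bholder g (fun t => h t + i t).
Proof.
move=> [C C0 [hC hH]] [D D0 [iD iH]]; exists (C + D); first by rewrite addr_ge0.
split=> [t|s t]; first by apply: le_trans (ler_normD _ _) _; apply: lerD.
rewrite opprD addrACA mulrDl; apply: le_trans (ler_normD _ _) _; exact: lerD.
Qed.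

Lemma bholderN {R : realType} (g : R) (h : R -> R) :
  bholder g h -> bholder g (fun t => - h t).
Proof.
move=> [C C0 [hC hH]]; exists C => //; split=> [t|s t]; first by rewrite normrN.
by rewrite -opprD normrN.
Qed.

Lemma bholderV {R : realType} (g : R) (h : R -> R) :
  (forall t, 1 <= `|h t|) -> bholder g h -> bholder g (fun t => (h t)^-1).
Proof.
move=> h1 [C C0 [hC hH]]; exists (1 + C); first by rewrite addr_ge0.
have hV t : `|(h t)^-1| <= 1 by rewrite normfV invf_le1// (lt_le_trans ltr01).
split=> [t|s t]; first by apply: le_trans (hV t) _; rewrite lerDl.
have hn t' : h t' != 0 by rewrite -normr_gt0 (lt_le_trans ltr01).
have -> : (h s)^-1 - (h t)^-1 = (h s)^-1 * (h t)^-1 * (h t - h s).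
  by field; rewrite !hn.
rewrite normrM [X in _ * X]distrC normrM.
apply: le_trans (ler_wpM2r (normr_ge0 _) (mulr_ile1 (normr_ge0 _) (normr_ge0 _) (hV s) (hV t))) _.
rewrite mul1r; apply: le_trans (hH s t) _.
by apply: ler_wpM2r; [exact: powR_ge0 | rewrite lerDr].
Qed.

Lemma periodic_bounded {R : realType} (e C : R) (h : R -> R) : 0 < e ->
  (forall t k, k \is a Num.int -> h (t + k) = h t) ->
  (forall s t, `|h s - h t| <= C * `|s - t| `^ e) -> bholder e h.
Proof.
move=> e0 hp hH.
have C0 : 0 <= C.
  by have := le_trans (normr_ge0 _) (hH 1 0); rewrite subr0 normr1 powR1 mulr1.
exists (`|h 0| + C); first by rewrite addr_ge0.
split=> [t|s t]; last first.
  by apply: le_trans (hH s t) _; rewrite ler_wpM2r ?powR_ge0// lerDr.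
have [k ki kt] := int_translate_near 0 t.
rewrite -(hp t k ki) -[h (t + k)](subrK (h 0)) addrC.
apply: le_trans (ler_normD _ _) _; apply: lerD => //.
apply: le_trans (hH _ _) _.
have := @ler_powR_base R e _ 1 (ltW e0) (normr_ge0 _) kt; rewrite powR1 => h1.
by rewrite ler_piMr.
Qed.

(** * Slopes along the orbits of an expanding map *)

(** The hypotheses isolate what the argument needs: an expanding bijection [F] of
    the line with inverse [G], compatible with integer translations and of
    bounded distortion, and a bounded periodic function [A] whose difference
    quotients change under [F] by the Hoelder function [Phi] up to a Hoelder
    error. *)
Section ExpandingCocycle.
Variables (R : realType) (lambda Lambda g K B C1 Cphi : R).
Variables (F G A Phi : R -> R).
Hypotheses (lambda_gt1 : 1 < lambda) (Lambda_gt0 : 0 < Lambda) (g_gt0 : 0 < g).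
Hypotheses (K_ge0 : 0 <= K) (C1_ge0 : 0 <= C1) (Cphi_ge0 : 0 <= Cphi).
Hypotheses (FK : cancel F G) (GK : cancel G F).
Hypothesis F_expand : forall a b, lambda * `|a - b| <= `|F a - F b|.
Hypothesis F_lip : forall a b, `|F a - F b| <= Lambda * `|a - b|.
Hypothesis F_distort : forall rho a b c e : R,
  `|a - b| <= rho -> `|a - c| <= rho -> `|c - e| <= rho ->
  `|F a - F b| * `|c - e| <= (1 + K * rho) * (`|a - b| * `|F c - F e|).
Hypothesis G_between : forall a b c,
  `|a - c| + `|c - b| = `|a - b| -> `|G a - G c| + `|G c - G b| = `|G a - G b|.
Hypothesis F_shift : forall t k, k \is a Num.int -> F (t + k) - F t \is a Num.int.
Hypothesis A_shift : forall t k, k \is a Num.int -> A (t + k) = A t.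
Hypothesis Phi_shift : forall t k, k \is a Num.int -> Phi (t + k) = Phi t.
Hypothesis A_bound : forall t, `|A t| <= B.
Hypothesis Phi_holder : forall a b, `|Phi a - Phi b| <= Cphi * `|a - b| `^ g.

Definition slope a b := (A b - A a) / (b - a).
Definition birkhoff n t := \sum_(0 <= i < n) Phi (iter i F t).

Hypothesis slope_F : forall a b, a != b ->
  `|slope (F a) (F b) - slope a b + Phi a| <= C1 * `|a - b| `^ g.

Let lambda_gt0 : 0 < lambda. Proof. exact: lt_trans lambda_gt1. Qed.

Lemma iterFK n x : iter n G (iter n F x) = x.
Proof. by elim: n x => // n IH x; rewrite iterSr /= FK IH. Qed.

Lemma iterGK n x : iter n F (iter n G x) = x.
Proof. by elim: n x => // n IH x; rewrite iterSr /= GK IH. Qed.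

Lemma iterF_neq n a b : a != b -> iter n F a != iter n F b.
Proof. by apply: contra_neq => /(congr1 (iter n G)); rewrite !iterFK. Qed.

Lemma iterG_neq n a b : a != b -> iter n G a != iter n G b.
Proof. by apply: contra_neq => /(congr1 (iter n F)); rewrite !iterGK. Qed.

Lemma iterF_expand n a b : lambda ^+ n * `|a - b| <= `|iter n F a - iter n F b|.
Proof.
elim: n => [|n IH]; first by rewrite expr0 mul1r.
rewrite /= exprS -mulrA; apply: le_trans (F_expand _ _).
by rewrite ler_pM2l.
Qed.

Lemma iterG_contract n a b : `|iter n G a - iter n G b| <= lambda ^- n * `|a - b|.
Proof.
rewrite ler_pdivlMl ?exprn_gt0//.
by apply: le_trans (iterF_expand _ _ _) _; rewrite !iterGK.
Qed.

Lemma iterG_between n a b c : `|a - c| + `|c - b| = `|a - b| ->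
  `|iter n G a - iter n G c| + `|iter n G c - iter n G b| = `|iter n G a - iter n G b|.
Proof. by move=> H; elim: n => //= n IH; apply: G_between. Qed.

Lemma iterF_shift n t k : k \is a Num.int ->
  iter n F (t + k) - iter n F t \is a Num.int.
Proof.
move=> ki; elim: n => [|n IH]; first by rewrite /= addrAC subrr add0r.
by have := F_shift (iter n F t) _ IH; rewrite (addrC (iter n F t)) subrK.
Qed.

Lemma birkhoff_shift n t k : k \is a Num.int -> birkhoff n (t + k) = birkhoff n t.
Proof.
move=> ki; apply: eq_bigr => i _.
by rewrite -[iter i F (t + k)](subrK (iter i F t)) addrC Phi_shift// iterF_shift.
Qed.

Lemma birkhoff_add m n t : birkhoff (m + n) t = birkhoff m t + birkhoff n (iter m F t).
Proof.
rewrite /birkhoff (big_cat_nat (n := m)) ?leq_addr//=; congr (_ + _).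
by rewrite -{1}[m]add0n big_addn addKn; apply: eq_bigr => i _; rewrite iterD.
Qed.

(** The sum of the geometric series of ratio [lambda ^ (- g)], without its first
    term. *)
Definition orbit_factor : R := (lambda `^ g - 1)^-1.

Let lg_gt1 : 1 < lambda `^ g.
Proof. by have := @gt0_ltr_powR R g g_gt0 1 lambda; rewrite !nnegrE powR1 ler01 ltW//; apply. Qed.

Lemma orbit_factor_ge0 : 0 <= orbit_factor.
Proof. by rewrite invr_ge0 subr_ge0 ltW. Qed.

(** Read backwards from time [n], distances along two orbits decay like
    [lambda ^ (- j)], so all the errors made on the way are controlled by the
    last distance. *)
Lemma orbit_sum n a b :
  \sum_(0 <= i < n) `|iter i F a - iter i F b| `^ g
    <= orbit_factor * `|iter n F a - iter n F b| `^ g.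
Proof.
elim: n => [|n IH]; first by rewrite big_nil mulr_ge0 ?orbit_factor_ge0 ?powR_ge0.
rewrite big_nat_recr//=.
set d := `|iter n F a - _|; set d' := `|F _ - _|.
have dd' : lambda `^ g * d `^ g <= d' `^ g.
  rewrite -powRM ?normr_ge0 ?(ltW lambda_gt0)//.
  apply: ler_powR_base; [exact: ltW | | exact: F_expand].
  by apply: mulr_ge0; [exact: ltW | exact: normr_ge0].
apply: le_trans (lerD IH (lexx _)) _.
apply: le_trans (ler_wpM2l orbit_factor_ge0 dd').
suff -> : orbit_factor * (lambda `^ g * d `^ g) = orbit_factor * d `^ g + d `^ g by [].
have ne : lambda `^ g - 1 != 0 by rewrite gt_eqF// subr_gt0.
by rewrite /orbit_factor; field.
Qed.

Lemma birkhoff_holder n a b :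
  `|birkhoff n a - birkhoff n b| <= Cphi * orbit_factor * `|iter n F a - iter n F b| `^ g.
Proof.
rewrite /birkhoff -sumrB (le_trans (ler_norm_sum _ _ _))//.
rewrite -mulrA; apply: le_trans (ler_wpM2l Cphi_ge0 (orbit_sum n a b)).
by rewrite mulr_sumr; apply: ler_sum => i _; apply: Phi_holder.
Qed.

(** The one-step relation telescopes, with errors summed by orbit_sum. *)
Lemma slope_iter n a b : a != b ->
  `|slope (iter n F a) (iter n F b) - slope a b + birkhoff n a|
    <= C1 * orbit_factor * `|iter n F a - iter n F b| `^ g.
Proof.
move=> ab.
rewrite -mulrA; apply: le_trans (ler_wpM2l C1_ge0 (orbit_sum n a b)).
elim: n => [|n IH].
  by rewrite /birkhoff !big_nil /= subrr addr0 normr0 mulr0.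
rewrite big_nat_recr//= mulrDr /birkhoff big_nat_recr//= -/(birkhoff n a).
have H := slope_F _ _ (iterF_neq n _ _ ab).
apply: le_trans (lerD IH H); apply: le_trans (ler_normD _ _).
by apply: ler_of_eq; congr `|_|; ring.
Qed.

(** The sum over [j >= 1] of [K * lambda ^ (- j)]. *)
Definition distortion_rate := K / (lambda - 1).

(** Bounded distortion of the iterates.  One step multiplies the ratio of two
    distances by at most [1 + K * rho'], where [rho'] bounds the diameter at that
    time, and these diameters decrease geometrically backwards from [rho], so
    the product of the factors is at most [expR (distortion_rate * rho)]. *)
Lemma distort_iter n rho a b c e :
  `|iter n F a - iter n F b| <= rho -> `|iter n F a - iter n F c| <= rho ->
  `|iter n F c - iter n F e| <= rho ->
  `|iter n F a - iter n F b| * `|c - e|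
    <= expR (distortion_rate * rho) * (`|a - b| * `|iter n F c - iter n F e|).
Proof.
elim: n rho => [|n IH] rho ab ac ce.
  have rho_ge0 : 0 <= rho by apply: le_trans ab.
  rewrite /= ler_peMl ?mulr_ge0// -expR0 ler_expR mulr_ge0// divr_ge0//.
  by rewrite subr_ge0 ltW.
have H u v : `|iter n.+1 F u - iter n.+1 F v| <= rho ->
    `|iter n F u - iter n F v| <= rho / lambda.
  by rewrite ler_pdivlMr// mulrC => h; apply: le_trans h; apply: F_expand.
have := IH _ (H _ _ ab) (H _ _ ac) (H _ _ ce).
have := F_distort _ _ _ _ _ (H _ _ ab) (H _ _ ac) (H _ _ ce).
rewrite [iter n.+1 F a]iterS [iter n.+1 F b]iterS [iter n.+1 F c]iterS [iter n.+1 F e]iterS.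
set x := iter n F a; set y := iter n F b; set z := iter n F c; set w := iter n F e.
move=> h1 h2.
have rho_ge0 : 0 <= rho by apply: le_trans ab.
have r'0 : 0 <= rho / lambda by rewrite divr_ge0// ltW.
have e1 : expR (distortion_rate * rho) =
    expR (distortion_rate * (rho / lambda)) * expR (K * (rho/lambda)).
  rewrite -expRD; congr expR; rewrite /distortion_rate; field.
  by rewrite (gt_eqF lambda_gt0) gt_eqF// subr_gt0.
have e2 : 1 + K * (rho/lambda) <= expR (K * (rho/lambda)) by exact: expR_ge1Dx.
rewrite e1.
have [->|ce0] := eqVneq c e; first by rewrite !subrr normr0 !mulr0.
have zw : z != w by apply: iterF_neq.
have zw0 : 0 < `|z - w| by rewrite normr_gt0 subr_eq0.
rewrite -(ler_pM2l zw0).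
apply: (@le_trans _ _ (((1 + K * (rho/lambda)) * (`|x - y| * `|F z - F w|)) * `|c - e|)).
  by rewrite mulrA [X in X * _ <= _]mulrC ler_wpM2r.
apply: (@le_trans _ _ ((1 + K * (rho/lambda)) * `|F z - F w| *
    (expR (distortion_rate * (rho / lambda)) * (`|a - b| * `|z - w|)))).
  rewrite -[leLHS]mulrA.
  rewrite [leLHS](_ : _ = (1 + K * (rho / lambda)) * `|F z - F w| *
    (`|x - y| * `|c - e|)); last by ring.
  by rewrite ler_wpM2l// mulr_ge0// addr_ge0// mulr_ge0.
rewrite [leRHS](_ : _ = expR (K * (rho/lambda)) * `|F z - F w| *
  (expR (distortion_rate * (rho / lambda)) * (`|a - b| * `|z - w|))); last by ring.
by rewrite ler_wpM2r// ?ler_wpM2r// !mulr_ge0// expR_ge0.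
Qed.

Lemma slope_shift a b k : k \is a Num.int -> slope (a + k) (b + k) = slope a b.
Proof.
move=> ki; rewrite /slope !A_shift//; congr (_ / _); ring.
Qed.

(** Pairs at distance one period serve as a reference, since their slope is
    known. *)
Lemma slope_period a : slope a (a + 1) = 0.
Proof. by rewrite /slope A_shift ?rpred1// subrr mul0r. Qed.

Lemma iterG_small (s : R) : 0 < s -> exists n, lambda ^- n < s.
Proof.
move=> s0.
have li : `|lambda^-1| < 1 by rewrite gtr0_norm ?invr_gt0// invf_lt1.
have /cvgrPdist_lt/(_ s s0)[n _ /(_ n (leqnn _))] := cvg_expr li.
rewrite sub0r normrN gtr0_norm ?exprn_gt0 ?invr_gt0// exprVn => h.
by exists n.
Qed.

(** Differentiability at [y] controls the slope of a pair [(P, X)] only if its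
    distance is not much smaller than its distances to [y].  For [P] and [X]
    pulled back by [G^n] from a unit neighbourhood of [F^n y], bounded distortion
    keeps the ratio of these distances under control while [n] grows. *)
Lemma slope_near_derivable y : derivable A y 1 -> exists l : R, forall s : R, 0 < s ->
  exists n, forall p x, s <= `|p - x| -> `|p - x| <= 1 -> `|p - iter n F y| <= 1 ->
    `|slope (iter n G p) (iter n G x) - l| <= 1.
Proof.
move=> /derivable_first_order[l Hl]; exists l => s s0.
pose E := expR (distortion_rate * 2).
have E0 : 0 < E by exact: expR_gt0.
have e0 : 0 < s / (3 * E) by rewrite divr_gt0// mulr_gt0.
have [d d0 Hd] := Hl _ e0.
have d20 : 0 < d / 2 by rewrite divr_gt0.
(* The pull-back of the ball of radius 2 around [F^n y] then fits in radius [d]. *)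
have [n Hn] := iterG_small _ d20.
exists n => p x spx px1 py1.
have xy2 : `|x - iter n F y| <= 2.
  by apply: le_trans (ler_distD p _ _) _; rewrite (distrC x p); lra.
set P := iter n G p; set X := iter n G x.
have near u : `|u - iter n F y| <= 2 -> `|iter n G u - y| < d.
  move=> u2; have := iterG_contract n u (iter n F y); rewrite iterFK => h.
  apply: le_lt_trans h _; apply: le_lt_trans (ler_wpM2l _ u2) _.
    by rewrite invr_ge0 exprn_ge0// ltW.
  by rewrite -ltr_pdivlMr.
have Pd : `|P - y| < d by apply: near; apply: le_trans py1 _; lra.
have Xd : `|X - y| < d by apply: near.
have PX : P != X by apply: iterG_neq; rewrite -subr_eq0 -normr_gt0 (lt_le_trans s0).
have hP : `|p - x| * `|P - y| <= E * (`|P - X| * `|p - iter n F y|).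
  have := @distort_iter n 2 P X P y; rewrite !iterGK subrr normr0; apply; lra.
have hX : `|p - x| * `|X - y| <= E * (`|P - X| * `|x - iter n F y|).
  have := @distort_iter n 2 P X X y; rewrite !iterGK; apply; lra.
have PX0 : 0 < `|X - P| by rewrite normr_gt0 subr_eq0 eq_sym.
have h : `|A X - A P - l * (X - P)| <= `|X - P|.
  have -> : A X - A P - l * (X - P) =
    (A X - A y - l * (X - y)) - (A P - A y - l * (P - y)) by ring.
  apply: le_trans (ler_normB _ _) _.
  apply: le_trans (lerD (Hd _ Xd) (Hd _ Pd)) _.
  rewrite -mulrDr mulrAC ler_pdivrMr ?mulr_gt0//.
  have hP' : s * `|P - y| <= E * `|X - P|.
    apply: le_trans (ler_wpM2r _ spx) _ => //; apply: le_trans hP _.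
    by rewrite ler_wpM2l ?(ltW E0)// distrC ler_piMr.
  have hX' : s * `|X - y| <= E * `|X - P| * 2.
    apply: le_trans (ler_wpM2r _ spx) _ => //; apply: le_trans hX _.
    by rewrite -mulrA ler_wpM2l ?(ltW E0)// distrC ler_wpM2l.
  rewrite mulrDr; apply: le_trans (lerD hX' hP') _.
  by apply: ler_of_eq; ring.
rewrite /slope.
have -> : (A X - A P) / (X - P) - l = (A X - A P - l * (X - P)) / (X - P).
  by rewrite [RHS]mulrBl mulfK// -normr_gt0.
by rewrite normrM normfV ler_pdivrMr// mul1r.
Qed.

(** The pairs [(p, q)] and [(p, p + 1)] have the same first point, so the same
    Birkhoff sum in slope_iter; it cancels in the difference of their slopes,
    whose pull-backs near [y] are both close to the derivative. *)
Lemma slope_bounded_of_derivable y : derivable A y 1 ->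
  exists L, forall z w, z != w -> `|z - w| <= 1 -> `|slope z w| <= L.
Proof.
move=> /slope_near_derivable[l Hl]; exists (2 * (C1 * orbit_factor) + 2) => z w zw zw1.
have zw0 : 0 < `|z - w| by rewrite normr_gt0 subr_eq0.
have [n Hn] := Hl _ zw0.
have [k ki kz] := int_translate_near (iter n F y) z.
rewrite -(slope_shift z w k)//; set p := z + k; set q := w + k.
have pq : `|p - q| = `|z - w| by congr `|_|; rewrite /p /q; ring.
have pp1 : `|p - (p + 1)| = 1 by rewrite opprD addrA subrr sub0r normrN normr1.
have h1 := Hn p q; have h2 := Hn p (p + 1).
have pneq : p != q by rewrite -subr_eq0 -normr_gt0 pq.
have pneq1 : p != p + 1 by rewrite -subr_eq0 -normr_gt0 pp1.
have := slope_iter n (iter n G p) (iter n G q) (iterG_neq _ _ _ pneq).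
have := slope_iter n (iter n G p) (iter n G (p + 1)) (iterG_neq _ _ _ pneq1).
rewrite !iterGK slope_period pp1 powR1 mulr1 pq => h3 h4.
have {}h1 : `|slope (iter n G p) (iter n G q) - l| <= 1 by apply: h1; rewrite ?pq.
have {}h2 : `|slope (iter n G p) (iter n G (p + 1)) - l| <= 1 by apply: h2; rewrite ?pp1.
have {}h4 : `|slope p q - slope (iter n G p) (iter n G q) + birkhoff n (iter n G p)|
    <= C1 * orbit_factor.
  apply: le_trans h4 _; rewrite ler_piMr// ?mulr_ge0// ?orbit_factor_ge0//.
  by have := ler_powR_base _ _ _ (ltW g_gt0) (normr_ge0 _) zw1; rewrite powR1.
move: h1 h2 h3 h4; rewrite !ler_norml => /andP[? ?] /andP[? ?] /andP[? ?] /andP[? ?].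
apply/andP; split; lra.
Qed.

Lemma birkhoff_iterate x p k n : k \is a Num.int -> iter p F x = x + k ->
  birkhoff (n * p) x = birkhoff p x *+ n.
Proof.
move=> ki xp; elim: n => [|n IH]; first by rewrite mul0n /birkhoff big_nil.
by rewrite mulSn birkhoff_add xp birkhoff_shift// IH mulrS.
Qed.

(** Comparing with the pair that [F^N] maps to [(F^N x, F^N x + 1)], of slope 0,
    the Lipschitz bound gives a bound on the Birkhoff sums of [x] independent of
    the number of periods. *)
Theorem periodic_sum_eq0 y x p k : derivable A y 1 ->
  k \is a Num.int -> iter p F x = x + k -> birkhoff p x = 0.
Proof.
move=> /slope_bounded_of_derivable[L HL] ki xp.
have bd n : `|birkhoff p x| *+ n <= L + C1 * orbit_factor.
  rewrite -normrMn -(birkhoff_iterate _ _ _ _ ki xp).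
  set N := (n * p)%N; pose b := iter N G (iter N F x + 1).
  have xb : x != b.
    rewrite -(iterFK N x) /b iterG_neq//.
    by rewrite -subr_eq0 opprD addrA subrr sub0r oppr_eq0 oner_eq0.
  have xb1 : `|x - b| <= 1.
    rewrite -(iterFK N x) /b; apply: le_trans (iterG_contract _ _ _) _.
    rewrite opprD addrA subrr sub0r normrN normr1 mulr1.
    by rewrite invf_le1 ?exprn_gt0// exprn_ege1// ltW.
  have := HL _ _ xb xb1; have := slope_iter N x b xb.
  rewrite /b iterGK slope_period opprD addrA subrr !sub0r normrN normr1 powR1 mulr1.
  rewrite !ler_norml => /andP[? ?] /andP[? ?]; apply/andP; split; lra.
apply/eqP; rewrite -normr_le0 leNgt; apply/negP => S0.
have := bd (Num.bound ((L + C1 * orbit_factor) / `|birkhoff p x|)); rewrite leNgt => /negP; apply.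
rewrite -mulr_natl -ltr_pdivrMr//.
apply: archi_boundP.
by rewrite divr_ge0// (le_trans _ (bd 0%N))// mulr0n.
Qed.

Hypothesis periodic0 : forall n x k,
  k \is a Num.int -> iter n F x = x + k -> birkhoff n x = 0.

Definition closing_factor : R := (1 - lambda^-1)^-1.

Let lambdaV_lt1 : lambda^-1 < 1. Proof. by rewrite invf_lt1. Qed.

Let closing_factor_gt0 : 0 < closing_factor. Proof. by rewrite invr_gt0 subr_gt0. Qed.

(** The map [G^n (_ + k)] is a contraction and its fixed point [x] closes up after
    [n] steps.  As [x] and [a] are closer than their images by a factor
    [lambda ^ n], the distance of the images is comparable with the gap left by
    the orbit of [a]. *)
Lemma closing n a k : (0 < n)%N -> k \is a Num.int ->
  exists2 x, iter n F x = x + k &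
    `|iter n F x - iter n F a| <= closing_factor * `|iter n F a - (a + k)|.
Proof.
case: n => // n _ ki.
have q1 : lambda ^- n.+1 <= lambda^-1.
  by rewrite lef_pV2 ?posrE ?exprn_gt0// ler_eXnr// ltW.
have [|||x Hx] := @contraction_fixpoint_line R (lambda ^- n.+1) (fun t => iter n.+1 G (t + k)).
- by rewrite invr_ge0 exprn_ge0// ltW.
- exact: le_lt_trans q1 _.
- move=> u w; apply: le_trans (iterG_contract _ _ _) _.
  by rewrite opprD addrACA subrr addr0.
have xk : iter n.+1 F x = x + k by rewrite -[in LHS]Hx iterGK.
exists x => //; set r := `|_ - _|; set s := `|_ - (a + k)|.
rewrite /closing_factor ler_pdivlMl ?subr_gt0// mulrBl mul1r lerBlDr.
have xa : `|x - a| <= lambda^-1 * r.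
  have := iterG_contract n.+1 (iter n.+1 F x) (iter n.+1 F a).
  rewrite !iterFK => h; apply: le_trans h _; exact: ler_wpM2r.
rewrite addrC; apply: le_trans (lerD xa (lexx s)).
rewrite /r /s xk; set y := iter n.+1 F a.
have -> : x + k - y = (x - a) - (y - (a + k)) by ring.
exact: ler_normB.
Qed.

Lemma birkhoff_recurrence n a k : k \is a Num.int ->
  `|birkhoff n a| <= Cphi * orbit_factor * (closing_factor * `|iter n F a - (a + k)|) `^ g.
Proof.
case: n => [|n] ki.
  by rewrite /birkhoff big_nil normr0 !mulr_ge0 ?orbit_factor_ge0 ?powR_ge0.
have [x xk xa] := closing n.+1 a k isT ki.
have := birkhoff_holder n.+1 x a; rewrite (periodic0 _ _ _ ki xk) sub0r normrN => h.
apply: le_trans h _; rewrite ler_wpM2l ?mulr_ge0 ?orbit_factor_ge0//.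
by rewrite ler_powR_base// ltW.
Qed.

Lemma birkhoff_bounded n a : `|birkhoff n a| <= Cphi * orbit_factor * closing_factor `^ g.
Proof.
have [k ki ak] := int_translate_near (iter n F a) a.
apply: le_trans (birkhoff_recurrence n _ _ ki) _.
apply: ler_wpM2l; first by rewrite mulr_ge0// orbit_factor_ge0.
apply: ler_powR_base; [exact: ltW | by rewrite mulr_ge0// ltW |].
by rewrite distrC ler_piMr// ltW.
Qed.

(** At the first time when the distance reaches [c] it was below [c] one step
    before. *)
Lemma expand_to_scale c a b : a != b -> `|a - b| < c ->
  exists n, c <= `|iter n F a - iter n F b| <= Lambda * c.
Proof.
move=> ab abc.
have ab0 : 0 < `|a - b| by rewrite normr_gt0 subr_eq0.
have c_gt0 : 0 < c by apply: lt_trans abc.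
have ex : exists n, c <= `|iter n F a - iter n F b|.
  have [n Hn] := iterG_small _ (divr_gt0 ab0 c_gt0).
  exists n; apply: le_trans (iterF_expand _ _ _).
  move: Hn; rewrite ltr_pdivlMr// => /ltW.
  by rewrite ler_pdivrMl ?exprn_gt0.
case: (ex_minnP ex) => -[|n]; first by rewrite /= leNgt abc.
move=> cn min; exists n.+1; rewrite cn /=.
apply: le_trans (F_lip _ _) _; rewrite ler_pM2l// ltW// ltNge.
by apply/negP => /min; rewrite ltnn.
Qed.

(** Expand the pair to unit size, where the bound on [A] bounds its slope, and
    come back by slope_iter, using that the Birkhoff sums are bounded. *)
Lemma slope_bounded : exists L,
  forall a b, a != b -> `|a - b| < 1 -> `|slope a b| <= L.
Proof.
have B0 : 0 <= B by apply: le_trans (A_bound 0).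
exists (2 * B + Cphi * orbit_factor * closing_factor `^ g
        + C1 * orbit_factor * Lambda `^ g) => a b ab ab1.
have [n /andP[n1 n2]] := expand_to_scale 1 a b ab ab1.
rewrite mulr1 in n2.
have h1 : `|slope (iter n F a) (iter n F b)| <= 2 * B.
  rewrite normrM normfV distrC [X in _ / X]distrC.
  rewrite ler_pdivrMr ?(lt_le_trans ltr01)//.
  apply: le_trans (ler_normB _ _) _; apply: le_trans (lerD (A_bound _) (A_bound _)) _.
  have -> : B + B = 2 * B by ring.
  by rewrite ler_peMr// mulr_ge0.
have h2 := birkhoff_bounded n a.
have h3 := slope_iter n a b ab.
have {}h3 := le_trans h3 (ler_wpM2l (mulr_ge0 C1_ge0 orbit_factor_ge0)
  (ler_powR_base _ _ _ (ltW g_gt0) (normr_ge0 _) n2)).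
move: h1 h2 h3; rewrite !ler_norml => /andP[? ?] /andP[? ?] /andP[? ?].
by apply/andP; split; lra.
Qed.

Lemma slopeC a b : slope a b = slope b a.
Proof. by rewrite /slope -opprB -(opprB a b) invrN mulrNN. Qed.

(** If all slopes near [t] are at most [m], the function [m * x - A x] is
    nondecreasing there, and the quantity [(m - slope a b) * |a - b|] is its
    increment, which is smaller on a subinterval. *)
Lemma slope_defect_sub m t r a b c e :
  (forall x y, x != y -> `|x - t| <= r -> `|y - t| <= r -> slope x y <= m) ->
  `|a - t| <= r -> `|b - t| <= r -> a != b -> c != e ->
  `|a - c| + `|c - b| = `|a - b| -> `|a - e| + `|e - b| = `|a - b| ->
  (m - slope c e) * `|c - e| <= (m - slope a b) * `|a - b|.
Proof.
move=> Hm ar br.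
wlog ab : a b ar br / a < b => [H ab ce|].
  move: (ab); rewrite neq_lt => /orP[ablt|balt]; first exact: H.
  rewrite (addrC `|a - c|) (addrC `|a - e|) (slopeC a b) !(distrC _ b) !(distrC a).
  by move=> h1 h2; apply: H; rewrite // eq_sym.
wlog ce : c e / c < e => [H|].
  move=> abn; rewrite neq_lt => /orP[cd|dc] h1 h2.
    by apply: H => //; rewrite lt_eqF.
  by rewrite slopeC distrC; apply: H => //; rewrite lt_eqF.
move=> _ _ /between_le/(_ (ltW ab))/andP[ac cb] /between_le/(_ (ltW ab))/andP[ae eb].
have u_mono x y : a <= x -> x <= y -> y <= b -> A y - A x <= m * (y - x).
  move=> ax; rewrite le_eqVlt => /orP[/eqP ->|xy] yb; first by rewrite !subrr mulr0.
  rewrite -ler_pdivrMr ?subr_gt0//; apply: Hm; first by rewrite lt_eqF.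
    move: ar br; rewrite !ler_norml => /andP[? ?] /andP[? ?]; apply/andP; split; lra.
  move: ar br; rewrite !ler_norml => /andP[? ?] /andP[? ?]; apply/andP; split; lra.
have defect x y : x < y -> (m - slope x y) * `|x - y| = m * (y - x) - (A y - A x).
  move=> xy; rewrite distrC gtr0_norm ?subr_gt0// mulrBl /slope divfK//.
  by rewrite subr_eq0 gt_eqF.
rewrite !defect//.
have := u_mono a c (lexx _) ac cb; have := u_mono e b ae eb (lexx _); lra.
Qed.

(** The pair [(z, w)] realizes the upper limit [M] up to [eta] and is expanded to
    size between 4 and [Lambda * 4], which is enough to cover the translate by
    [k] of the ball of radius [r] around [t].  The pair [(z1, w1)] is the
    pull-back of [(p + k, q + k)]: its slope is at least [M - r ^ g] by
    slope_defect_sub, and its Birkhoff sum is [O(r ^ g)] because [z1] and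
    [F^n z1 - k = p] are both in the ball. *)
Lemma slope_lower_bound t M :
  (forall e, 0 < e -> exists2 r, 0 < r & forall a b, a != b ->
      `|a - t| <= r -> `|b - t| <= r -> slope a b <= M + e) ->
  (forall e r, 0 < e -> 0 < r -> exists a b, [/\ a != b,
      `|a - t| <= r, `|b - t| <= r & M - e <= slope a b]) ->
  exists2 C, 0 < C & forall r p q, 0 < r -> r <= 1 -> p != q ->
    `|p - t| <= r -> `|q - t| <= r -> M - C * r `^ g <= slope p q.
Proof.
move=> Mup Mlow.
exists (1 + Cphi * orbit_factor * (closing_factor * 2) `^ g + C1 * orbit_factor * 2 `^ g).
  by rewrite -addrA ltr_wpDr// addr_ge0// !mulr_ge0// ?orbit_factor_ge0// powR_ge0.
move=> r p q r0 r1 pq pt qt.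
pose N := Lambda * 4; pose E := expR (distortion_rate * N).
have N0 : 0 < N by rewrite mulr_gt0.
have E0 : 0 < E by exact: expR_gt0.
have pq0 : 0 < `|p - q| by rewrite normr_gt0 subr_eq0.
have rg0 : 0 < r `^ g by apply: powR_gt0.
(* With this value the defect [2 * eta], divided by the relative size of
   [(z1, w1)] in [(z, w)], is at most [r ^ g]. *)
pose eta := r `^ g * `|p - q| / (2 * E * N).
have eta0 : 0 < eta by rewrite divr_gt0 ?mulr_gt0.
have [r2 r20 Hr2] := Mup _ eta0.
pose d := Num.min r2 r.
have d0 : 0 < d by rewrite lt_min r20.
have dr2 : d <= r2 by rewrite ge_min lexx.
have dr : d <= r by rewrite ge_min lexx orbT.
have [z [w [zw zt wt zwM]]] := Mlow _ _ eta0 d0.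
have zw0 : 0 < `|z - w| by rewrite normr_gt0 subr_eq0.
have zw4 : `|z - w| < 4.
  by apply: le_lt_trans (ler_distD t _ _) _; rewrite (distrC t w); lra.
have [n /andP[n4 nN]] := expand_to_scale 4 z w zw zw4.
set Z := iter n F z in n4 nN; set W := iter n F w in n4 nN.
have [k ki kt] := int_translate_near ((Z + W) / 2) t.
have mid x : `|x - t| <= r -> `|Z - (x + k)| + `|(x + k) - W| = `|Z - W|.
  move=> xt; apply: between_midpoint.
  have -> : x + k - (Z + W) / 2 = (x - t) + (t + k - (Z + W) / 2) by ring.
  by apply: le_trans (ler_normD _ _) _; lra.
pose z1 := iter n G (p + k); pose w1 := iter n G (q + k).
have btw x : `|x - t| <= r ->
    `|z - iter n G (x + k)| + `|iter n G (x + k) - w| = `|z - w|.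
  by move=> xt; have := iterG_between n _ _ _ (mid x xt); rewrite !iterFK.
have zw1 : z1 != w1.
  by apply: iterG_neq; apply: contra_neq pq => /(congr1 (fun x => x - k)); rewrite !addrK.
have zw10 : 0 < `|z1 - w1| by rewrite normr_gt0 subr_eq0.
have pqk : `|p + k - (q + k)| = `|p - q| by congr `|_|; ring.
have dist : `|p - q| * `|z - w| <= E * (`|z1 - w1| * `|Z - W|).
  have := @distort_iter n N z1 w1 z w; rewrite !iterGK pqk; apply=> //.
    apply: le_trans (ler_distD t _ _) _; rewrite (distrC t q).
    by apply: le_trans nN; apply: le_trans n4; lra.
  rewrite distrC; apply: le_trans nN; rewrite -(mid p pt) lerDl; exact: normr_ge0.
have def : (M + eta - slope z1 w1) * `|z1 - w1| <= (M + eta - slope z w) * `|z - w|.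
  apply: (@slope_defect_sub (M + eta) t r2) => //; rewrite ?btw//.
  - exact: le_trans zt dr2.
  - exact: le_trans wt dr2.
have low1 : M - r `^ g <= slope z1 w1.
  have h1 : (M + eta - slope z w) * `|z - w| <= 2 * eta * `|z - w|.
    by rewrite ler_wpM2r//; lra.
  have h2 : eta * (2 * E * N) = r `^ g * `|p - q|.
    by rewrite /eta divfK// gt_eqF// !mulr_gt0.
  have h3 : (M + eta - slope z1 w1) * (`|z1 - w1| * `|p - q|)
              <= r `^ g * (`|z1 - w1| * `|p - q|).
    rewrite mulrA; apply: le_trans (ler_wpM2r (ltW pq0) (le_trans def h1)) _.
    rewrite [leLHS](_ : _ = 2 * eta * (`|p - q| * `|z - w|)); last by ring.
    have e20 : 0 <= 2 * eta by rewrite mulr_ge0// ltW.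
    apply: le_trans (ler_wpM2l e20 dist) _.
    rewrite [leRHS](_ : _ = `|z1 - w1| * (r `^ g * `|p - q|)); last by ring.
    rewrite -h2.
    rewrite [leLHS](_ : _ = `|z1 - w1| * (eta * (2 * E * `|Z - W|))); last by ring.
    apply: ler_wpM2l => //; apply: ler_wpM2l; first exact: ltW.
    by apply: ler_wpM2l => //; rewrite mulr_ge0// ltW.
  by move: h3; rewrite ler_pM2r ?mulr_gt0//; lra.
have z1t : `|z1 - t| <= r.
  have := btw p pt; rewrite -/z1 => hb.
  wlog zlew : z w zt wt hb {zw zwM zw0 zw4 n4 nN Z W kt mid btw dist def} / z <= w => [H|].
    have [/H|/ltW/H] := leP z w; first by apply.
    by apply=> //; rewrite (distrC w z) -hb addrC (distrC w) (distrC z).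
  have /andP[? ?] := between_le _ _ _ hb zlew.
  move: zt wt; rewrite !ler_norml => /andP[? ?] /andP[? ?]; apply/andP; split; lra.
have hsum : `|birkhoff n z1| <= Cphi * orbit_factor * (closing_factor * 2) `^ g * r `^ g.
  apply: le_trans (birkhoff_recurrence n z1 _ ki) _.
  rewrite -[leRHS]mulrA -powRM ?mulr_ge0 ?(ltW closing_factor_gt0) ?(ltW r0)//.
  apply: ler_wpM2l; first by rewrite mulr_ge0// orbit_factor_ge0.
  apply: ler_powR_base; [exact: ltW | by rewrite mulr_ge0// ltW |].
  rewrite -mulrA; apply: ler_wpM2l; [exact: ltW | rewrite /z1 iterGK -/z1].
  have -> : p + k - (z1 + k) = (p - t) - (z1 - t) by ring.
  by apply: le_trans (ler_normB _ _) _; lra.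
have := slope_iter n z1 w1 zw1; rewrite !iterGK slope_shift// pqk => h.
have {h} : `|slope p q - slope z1 w1 + birkhoff n z1| <= C1 * orbit_factor * 2 `^ g * r `^ g.
  apply: le_trans h _; rewrite -[leRHS]mulrA -powRM ?(ltW r0)//.
  apply: ler_wpM2l; first by rewrite mulr_ge0// orbit_factor_ge0.
  apply: ler_powR_base; [exact: ltW | exact: normr_ge0 |].
  by apply: le_trans (ler_distD t _ _) _; rewrite (distrC t q); lra.
move: hsum; rewrite !ler_norml => /andP[? ?] /andP[? ?].
rewrite !mulrDl; lra.
Qed.

Theorem derivable_of_periodic_sums t : derivable A t 1.
Proof.
have [L HL] := slope_bounded.
have [M [Mup Mlow]] := local_limsup slope t L HL.
have [C C0 HC] := slope_lower_bound t M Mup Mlow.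
apply: (derivable_of_slope A t M) => e e0.
have [r1 r10 Hr1] := Mup e e0.
(* The solution of [C * r2 ^ g = e]. *)
pose r2 := (e / C) `^ (g^-1).
have r20 : 0 < r2 by rewrite powR_gt0// divr_gt0.
have r2E : C * r2 `^ g = e.
  rewrite /r2 -powRrM mulVf ?gt_eqF// powRr1 ?divr_ge0 ?ltW//.
  by rewrite mulrC divfK// gt_eqF.
pose r := Num.min 1 (Num.min r1 r2).
have r0 : 0 < r by rewrite !lt_min r10 r20 ltr01.
have rr1 : r <= r1 by rewrite !ge_min lexx orbT.
have rr2 : r <= r2 by rewrite !ge_min lexx !orbT.
have rle1 : r <= 1 by rewrite !ge_min lexx.
exists r => // x xt /ltW xr.
have tt s : 0 < s -> `|t - t| <= s by move=> s0; rewrite subrr normr0 ltW.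
have tx : t != x by rewrite eq_sym.
have := Hr1 t x tx (tt _ r10) (le_trans xr rr1).
have := HC r t x r0 rle1 tx (tt _ r0) xr.
have : C * r `^ g <= e.
  by rewrite -r2E ler_pM2l//; apply: ler_powR_base; rewrite ?(ltW g_gt0) ?(ltW r0).
rewrite -/(slope t x) ler_norml => h1 h2 h3; apply/andP; split; lra.
Qed.

End ExpandingCocycle.

(** * Expanding maps of the line *)

(** The function [A] is given through the series that defines it, with partial
    sums [partial_sum N]; these satisfy a recursion that mirrors the functional
    equation, so bounds are proved for them by induction and passed to the
    limit. *)
Section Line.
Variables (R : realType) (lambda e : R) (F F1 F2 V V1 A : R -> R).
Hypotheses (e_gt0 : 0 < e) (e_lt1 : e < 1) (lambda_gt1 : 1 < lambda).
Hypothesis dF : forall t : R, is_derive t (1 : R) F (F1 t).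
Hypothesis dF1 : forall t : R, is_derive t (1 : R) F1 (F2 t).
Hypothesis dV : forall t : R, is_derive t (1 : R) V (V1 t).
Hypotheses (F2_holder : exists C, forall s t, `|F2 s - F2 t| <= C * `|s - t| `^ e).
Hypotheses (V1_holder : exists C, forall s t, `|V1 s - V1 t| <= C * `|s - t| `^ e).
Hypothesis F_shift : forall t k, k \is a Num.int -> F (t + k) - F t \is a Num.int.
Hypothesis V_shift : forall t k, k \is a Num.int -> V (t + k) = V t.
Hypothesis F1_large : forall t, lambda < `|F1 t|.

Let lambda_gt0 : 0 < lambda. Proof. exact: lt_trans lambda_gt1. Qed.

Lemma F1_shift t k : k \is a Num.int -> F1 (t + k) = F1 t.
Proof. exact: (derivative_periodic F F1 dF F_shift). Qed.

Lemma F2_shift t k : k \is a Num.int -> F2 (t + k) = F2 t.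
Proof.
apply: (derivative_periodic F1 F2 dF1) => x l li.
by rewrite F1_shift// subrr rpred0.
Qed.

Lemma V1_shift t k : k \is a Num.int -> V1 (t + k) = V1 t.
Proof.
apply: (derivative_periodic V V1 dV) => x l li.
by rewrite V_shift// subrr rpred0.
Qed.

Lemma F2_bholder : bholder e F2.
Proof.
have [C HC] := F2_holder.
exact: (periodic_bounded e C F2 e_gt0 F2_shift HC).
Qed.

Lemma V1_bholder : bholder e V1.
Proof.
have [C HC] := V1_holder.
exact: (periodic_bounded e C V1 e_gt0 V1_shift HC).
Qed.

Lemma F1_bholder : bholder 1 F1.
Proof.
have [C C0 [hC _]] := F2_bholder.
apply: (periodic_bounded 1 C F1 ltr01 F1_shift) => s t.
by rewrite powRr1//; exact: (lipschitz_of_derive_bound F1 F2 C dF1 hC).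
Qed.

Lemma V_bholder : bholder 1 V.
Proof.
have [C C0 [hC _]] := V1_bholder.
apply: (periodic_bounded 1 C V ltr01 V_shift) => s t.
by rewrite powRr1//; exact: (lipschitz_of_derive_bound V V1 C dV hC).
Qed.

(** [F1] is continuous and does not vanish. *)
Lemma F1_sign : exists2 s : R, s = 1 \/ s = -1 & forall t, lambda < s * F1 t.
Proof.
have nosign a b : F1 a < 0 -> 0 < F1 b -> False.
  move=> a0 b0.
  have cont x y : {within `[x, y], continuous F1}%classic.
    by apply: continuous_subspaceT; exact: (is_derive_continuous F1 F2 dF1).
  suff [c c0] : exists c, F1 c = 0.
    have := F1_large c; rewrite c0 normr0; have := lambda_gt0; lra.
  have [ab|/ltW ba] := leP a b.
    have [|c _ cE] := IVT (v := 0) ab (cont a b); last by exists c.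
    by rewrite ge_min le_max (ltW a0) (ltW b0) orbT.
  have [|c _ cE] := IVT (v := 0) ba (cont b a); last by exists c.
  by rewrite ge_min le_max (ltW a0) (ltW b0) orbT.
have [p0|n0|z0] := ltrgt0P (F1 0); last first.
- by have := F1_large 0; rewrite z0 normr0; have := lambda_gt0; lra.
- exists (-1); first by right.
  move=> t; have := F1_large t; rewrite mulN1r.
  have [p|n|->] := ltrgt0P (F1 t); rewrite ?oppr0//.
  by have := nosign _ _ n0 p.
- exists 1; first by left.
  move=> t; have := F1_large t; rewrite mul1r.
  have [p|n|->] := ltrgt0P (F1 t) => //.
  by have := nosign _ _ n p0.
Qed.

Lemma F_expand a b : lambda * `|a - b| <= `|F a - F b|.
Proof.
have [c _ ->] := mean_value F F1 b a dF.
by rewrite normrM ler_wpM2r// ltW.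
Qed.

Lemma F_sign_mono (s : R) : (forall t, lambda < s * F1 t) ->
  forall a b, a <= b -> lambda * (b - a) <= s * F b - s * F a.
Proof.
move=> hs a b ab; have [c _ E] := mean_value F F1 a b dF.
by rewrite -mulrBr E mulrA ler_wpM2r ?subr_ge0// ltW.
Qed.

(** As [F] expands, a step of length [|y - F 0|] on either side of 0 is enough to
    reach [y]. *)
Lemma F_surj y : exists x, F x = y.
Proof.
have [s s1 hs] := F1_sign.
have ss : s * s = 1 by case: s1 => ->; ring.
pose c := `|s * y - s * F 0|.
have c0 : 0 <= c by exact: normr_ge0.
have m1 := F_sign_mono s hs 0 c c0.
have m2 : lambda * (0 - - c) <= s * F 0 - s * F (- c) by apply: F_sign_mono => //; lra.
have lc : c <= lambda * c by rewrite ler_peMl// ltW.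
have [] := @IVT R (fun x => s * F x) (- c) c (s * y).
- by lra.
- apply: continuous_subspaceT => x; apply: continuousM; first exact: cvg_cst.
  exact: (is_derive_continuous F F1 dF).
- have : - c <= s * y - s * F 0 <= c by rewrite -ler_norml.
  move=> /andP[h1 h2]; rewrite ge_min le_max; apply/andP; split; apply/orP.
    by left; lra.
  by right; lra.
move=> x _ E; exists x.
by rewrite -[F x]mul1r -ss -mulrA E mulrA ss mul1r.
Qed.

Lemma F_inverse : exists2 G : R -> R, cancel F G & cancel G F.
Proof.
have [G HG] := boolp.choice F_surj; exists G => // x.
apply/eqP; rewrite -subr_eq0 -normr_le0 -(ler_pM2l lambda_gt0) mulr0.
by apply: le_trans (F_expand _ _) _; rewrite HG subrr normr0.
Qed.

Lemma inverse_between (G : R -> R) : cancel G F -> forall a b c,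
  `|a - c| + `|c - b| = `|a - b| -> `|G a - G c| + `|G c - G b| = `|G a - G b|.
Proof.
move=> GK; have [s s1 hs] := F1_sign.
have ss : s * s = 1 by case: s1 => ->; ring.
have norms x : `|s * x| = `|x| by case: s1 => ->; rewrite ?mul1r// mulN1r normrN.
have mono a b : a <= b -> s * G a <= s * G b.
  move=> ab; rewrite leNgt; apply/negP; case: s1 hs => -> hs.
    rewrite !mul1r => h; have := F_sign_mono 1 hs _ _ (ltW h); rewrite !GK => h2.
    have : 0 < lambda * (G a - G b) by rewrite mulr_gt0// subr_gt0.
    lra.
  rewrite !mulN1r ltrN2 => h; have := F_sign_mono _ hs _ _ (ltW h); rewrite !GK => h2.
  have : 0 < lambda * (G b - G a) by rewrite mulr_gt0// subr_gt0.
  lra.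
have key a b c : a <= c -> c <= b ->
    `|G a - G c| + `|G c - G b| = `|G a - G b|.
  move=> ac cb; have h1 := mono _ _ ac; have h2 := mono _ _ cb.
  rewrite -!(norms (_ - _)) !mulrBr !ler0_norm; lra.
move=> a b c; have [ab|/ltW ba] := leP a b.
  by move=> /between_le/(_ ab)/andP[ac cb]; apply: key.
rewrite addrC (distrC c b) (distrC a c) (distrC a b) => /between_le/(_ ba)/andP[bc ca].
by rewrite addrC (distrC (G c)) (distrC (G a)) (distrC (G a)) key.
Qed.

Lemma F1_neq0 t : F1 t != 0.
Proof. by rewrite -normr_gt0 (lt_trans lambda_gt0). Qed.

(** One step multiplies Hoelder constants of exponent [g] by at most
    [Lam ^ g / lambda], so a small exponent is needed for this to contract. *)
Lemma small_exponent (Lam : R) : lambda < Lam ->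
  exists g, [/\ 0 < g, g <= e & lambda^-1 * Lam `^ g < 1].
Proof.
move=> lL.
have ll0 : 0 < ln lambda by rewrite ln_gt0.
have Lam1 : 1 < Lam by apply: lt_trans lL.
have lL0 : 0 < ln Lam by rewrite ln_gt0.
(* [Lam ^ g2] is the square root of [lambda]. *)
pose g2 := ln lambda / (2 * ln Lam).
have g20 : 0 < g2 by rewrite divr_gt0// mulr_gt0.
exists (Num.min e g2); split; first by rewrite lt_min e_gt0.
  by rewrite ge_min lexx.
rewrite mulrC ltr_pdivrMr// mul1r.
apply: (@le_lt_trans _ _ (Lam `^ g2)).
  by apply: ler_powR; [exact: ltW | rewrite ge_min lexx orbT].
rewrite -[X in X `^ _](lnK (x := Lam)) ?posrE ?(lt_trans ltr01)//.
rewrite -[ltRHS](lnK (x := lambda)) ?posrE//.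
rewrite -expRM ltr_expR /g2.
rewrite [ltLHS](_ : _ = ln lambda / 2); first by lra.
by field; rewrite gt_eqF.
Qed.

Definition multiplier n t := \prod_(0 <= j < n) F1 (iter j F t).
Definition partial_sum N t := \sum_(0 <= i < N) V (iter i F t) / multiplier i.+1 t.

Lemma multiplierS n t : multiplier n.+1 t = F1 t * multiplier n (F t).
Proof.
rewrite /multiplier big_nat_recl//=; congr (_ * _).
by apply: eq_bigr => i _; rewrite -iterSr.
Qed.

Lemma partial_sumS N t : partial_sum N.+1 t = (V t + partial_sum N (F t)) / F1 t.
Proof.
rewrite /partial_sum big_nat_recl//= mulrDl; congr (_ + _).
  by rewrite multiplierS /multiplier big_geq// mulr1.
rewrite mulr_suml; apply: eq_bigr => i _.
by rewrite multiplierS -iterSr invfM mulrA mulrAC.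
Qed.

(** The bound is the fixed point of [B |-> (C + B) / lambda]. *)
Lemma partial_sum_bounded : exists2 B, 0 <= B & forall N t, `|partial_sum N t| <= B.
Proof.
have [C C0 [hC _]] := V_bholder.
have l1 : 0 < lambda - 1 by rewrite subr_gt0.
exists (C / (lambda - 1)); first by rewrite divr_ge0// ltW.
elim=> [|N IH] t; first by rewrite /partial_sum big_geq// normr0 divr_ge0// ltW.
rewrite partial_sumS normrM normfV ler_pdivrMr ?(lt_trans lambda_gt0)//.
apply: le_trans (ler_normD _ _) _; apply: le_trans (lerD (hC t) (IH _)) _.
apply: (@le_trans _ _ (C / (lambda - 1) * lambda)).
  by apply: ler_of_eq; field; rewrite gt_eqF.
by apply: ler_wpM2l; [rewrite divr_ge0// ltW | exact: ltW].
Qed.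

Lemma multiplier_large n t : lambda ^+ n <= `|multiplier n t|.
Proof.
elim: n t => [|n IH] t; first by rewrite /multiplier big_geq// normr1.
rewrite multiplierS exprS normrM; apply: ler_pM => //; first exact: ltW.
  by rewrite exprn_ge0// ltW.
exact: ltW.
Qed.

Lemma partial_sum_cvg t : cvgn (fun N => partial_sum N t).
Proof.
have [C C0 [hC _]] := V_bholder.
apply: (@normed_cvg _ R (fun i => V (iter i F t) / multiplier i.+1 t)).
apply: (@series_le_cvg _ _ (geometric C lambda^-1)).
- by move=> n; exact: normr_ge0.
- by move=> n; rewrite /geometric /= mulr_ge0// exprn_ge0// invr_ge0 ltW.
- move=> n; rewrite /geometric /= normrM normfV exprVn.
  apply: ler_pM => //; rewrite lef_pV2 ?posrE ?exprn_gt0//.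
    apply: le_trans (multiplier_large _ _); rewrite exprS ler_peMl ?exprn_ge0 ?ltW//.
  by apply: lt_le_trans (multiplier_large _ _); rewrite exprn_gt0.
- apply: is_cvg_geometric_series.
  by rewrite ger0_norm ?invr_ge0 ?ltW// invf_lt1.
Qed.

Hypothesis A_lim : forall t, ((fun N => partial_sum N t) @ \oo --> - A t)%classic.
Definition Phi t := - ((V1 t + A t * F2 t) / F1 t).

Lemma A_equation t : A (F t) = V t + F1 t * A t.
Proof.
have h1 : ((fun N => partial_sum N.+1 t) @ \oo --> - A t)%classic.
  by have := A_lim t; rewrite -(cvg_shiftS (fun N => partial_sum N t)).
have h2 : ((fun N => partial_sum N.+1 t) @ \oo --> (V t + - A (F t)) / F1 t)%classic.
  under eq_fun do rewrite partial_sumS.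
  apply: cvgM; last exact: cvg_cst.
  apply: cvgD; [exact: cvg_cst | exact: A_lim].
have := cvg_unique _ h1 h2 => /(_ _) E.
have -> : F1 t * A t = - (F1 t * - A t) by ring.
rewrite E //; field; exact: F1_neq0.
Qed.

Lemma A_shift t k : k \is a Num.int -> A (t + k) = A t.
Proof.
move=> ki; suff E N : partial_sum N (t + k) = partial_sum N t.
  apply: oppr_inj.
  rewrite -(cvg_lim (@norm_hausdorff _ R) (A_lim t)).
  rewrite -(cvg_lim (@norm_hausdorff _ R) (A_lim (t + k))).
  by under eq_fun do rewrite E.
elim: N => [|N IH] in t k ki *; first by rewrite /partial_sum !big_geq.
rewrite !partial_sumS V_shift// F1_shift//; congr ((_ + _) / _).
have := F_shift t k ki; set m := F (t + k) - F t => mi.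
by have := IH (F t) m mi; rewrite /m addrC subrK.
Qed.

Lemma A_bounded : exists B, forall t, `|A t| <= B.
Proof.
have [B _ hB] := partial_sum_bounded; exists B => // t.
rewrite -normrN; apply: norm_lim_le (A_lim t) _ => N; exact: hB.
Qed.

(** The constant [K] is the fixed point of the affine inequality that the
    recursion gives for Hoelder constants, hence the same for all partial
    sums. *)
Lemma A_bholder (g Lam : R) : 0 < g -> g <= 1 -> lambda^-1 * Lam `^ g < 1 ->
  0 <= Lam -> (forall t, `|F1 t| <= Lam) -> bholder g A.
Proof.
move=> g0 g1 q1 Lam0 F1L.
have [B B0 hB] := partial_sum_bounded.
have FVb : bholder g (fun t => (F1 t)^-1).
  apply: bholderV; first by move=> t; rewrite ltW// (lt_trans lambda_gt1).
  exact: bholder_weaken F1_bholder.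
have [Ci Ci0 [_ hi]] := FVb.
have [Cw Cw0 [_ hw]] := bholderM _ _ _ (ltW g0) (bholder_weaken _ _ _ g0 g1 V_bholder) FVb.
pose q := lambda^-1 * Lam `^ g.
have q0 : 0 <= q by rewrite mulr_ge0 ?powR_ge0// invr_ge0 ltW.
pose K := (Cw + B * Ci) / (1 - q).
have K0 : 0 <= K by apply: divr_ge0; [rewrite addr_ge0// mulr_ge0 | rewrite subr_ge0 ltW].
have hP N a b : `|partial_sum N a - partial_sum N b| <= K * `|a - b| `^ g.
  elim: N a b => [|N IH] a b.
    by rewrite /partial_sum !big_geq// subrr normr0 mulr_ge0 ?powR_ge0.
  rewrite !partial_sumS.
  have -> : (V a + partial_sum N (F a)) / F1 a - (V b + partial_sum N (F b)) / F1 b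
    = (V a / F1 a - V b / F1 b) + partial_sum N (F a) * ((F1 a)^-1 - (F1 b)^-1)
      + (partial_sum N (F a) - partial_sum N (F b)) / F1 b by ring.
  apply: le_trans (ler_normD _ _) _.
  have h1 : `|(V a / F1 a - V b / F1 b) + partial_sum N (F a) * ((F1 a)^-1 - (F1 b)^-1)|
      <= (Cw + B * Ci) * `|a - b| `^ g.
    apply: le_trans (ler_normD _ _) _; rewrite mulrDl; apply: lerD; first exact: hw.
    by rewrite normrM -mulrA; apply: ler_pM => //; exact: hB.
  have h2 : `|(partial_sum N (F a) - partial_sum N (F b)) / F1 b| <= K * q * `|a - b| `^ g.
    rewrite normrM normfV.
    have h3 : `|F a - F b| `^ g <= Lam `^ g * `|a - b| `^ g.
      rewrite -powRM//; apply: ler_powR_base; [exact: ltW | exact: normr_ge0 |].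
      exact: (lipschitz_of_derive_bound F F1 Lam dF F1L).
    have h4 : `|F1 b|^-1 <= lambda^-1.
      by rewrite lef_pV2 ?posrE//; [exact: ltW | exact: lt_trans (F1_large b)].
    have h5 := le_trans (IH (F a) (F b)) (ler_wpM2l K0 h3).
    apply: le_trans (ler_pM _ _ h5 h4) _ => //.
    by apply: ler_of_eq; rewrite /q; ring.
  apply: le_trans (lerD h1 h2) _; rewrite -mulrDl; apply: ler_wpM2r; first exact: powR_ge0.
  apply: ler_of_eq.
  by rewrite /K; field; rewrite gt_eqF// subr_gt0.
exists (B + K); first by rewrite addr_ge0.
split=> [t|s t].
  apply: (@le_trans _ _ B); last by rewrite lerDl.
  by rewrite -normrN; apply: norm_lim_le (A_lim t) _ => N; exact: hB.
apply: (@le_trans _ _ (K * `|s - t| `^ g)); last first.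
  by apply: ler_wpM2r; [exact: powR_ge0 | rewrite lerDr].
rewrite -normrN.
apply: (@norm_lim_le _ (fun N => partial_sum N s - partial_sum N t)); last by move=> N; exact: hP.
have -> : - (A s - A t) = - A s - - A t by ring.
apply: cvgB; exact: A_lim.
Qed.

(** By the mean value theorem the new slope is
    [(V1 c1 + F2 c2 * A a) / F1 c3 + F1 b / F1 c3 * slope a b].  The first term
    is [- Phi a] up to a Hoelder error.  In the second, [F1 b / F1 c3 - 1] is
    [O(|b - a|)], which turns the possibly unbounded slope into the increment
    [A b - A a], and this is [O(|b - a| ^ g)]. *)
Lemma slope_step (g : R) : 0 < g -> g <= e -> bholder g A ->
  exists2 C, 0 <= C & forall a b, a != b ->
    `|slope R A (F a) (F b) - slope R A a b + Phi a| <= C * `|a - b| `^ g.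
Proof.
move=> g0 ge [CA CA0 [bA hA]].
have g1 : g <= 1 by apply: le_trans ge _; exact: ltW.
have FVb : bholder g (fun t => (F1 t)^-1).
  apply: bholderV; first by move=> t; rewrite ltW// (lt_trans lambda_gt1).
  exact: bholder_weaken F1_bholder.
have [M M0 [bM _]] := F2_bholder.
have [C1 C10 h1] := bholder_product_near _ _ _ (ltW g0) (bholder_weaken _ _ _ g0 ge V1_bholder) FVb.
have [C2 C20 h2] := bholder_product_near _ _ _ (ltW g0) (bholder_weaken _ _ _ g0 ge F2_bholder) FVb.
exists (C1 + CA * C2 + M * CA); first by rewrite !addr_ge0 ?mulr_ge0.
move=> a b ab.
have ba0 : b - a != 0 by rewrite subr_eq0 eq_sym.
have [c1 /between_dist[c1a _] E1] := mean_value V V1 a b dV.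
have [c2 /between_dist[c2a _] E2] := mean_value F1 F2 a b dF1.
have [c3 /between_dist[c3a c3b] E3] := mean_value F F1 a b dF.
have split : slope R A (F a) (F b) - slope R A a b + Phi a
  = (V1 c1 * (F1 c3)^-1 - V1 a * (F1 a)^-1)
    + A a * (F2 c2 * (F1 c3)^-1 - F2 a * (F1 a)^-1)
    + (F1 b - F1 c3) * (F1 c3)^-1 * ((A b - A a) / (b - a)).
  have num : A (F b) - A (F a) = V1 c1 * (b - a) + F2 c2 * (b - a) * A a + F1 b * (A b - A a).
    by rewrite -E1 -E2 !A_equation; ring.
  rewrite /slope /Phi num E3; field.
  by rewrite ba0 !F1_neq0.
rewrite split; apply: le_trans (ler_normD _ _) _; rewrite [leRHS]mulrDl; apply: lerD.
  apply: le_trans (ler_normD _ _) _; rewrite [leRHS]mulrDl [`|a - b|]distrC; apply: lerD.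
    exact: h1.
  by rewrite normrM -mulrA; apply: ler_pM => //; exact: h2.
rewrite !normrM !normfV.
have h3 : `|F1 b - F1 c3| <= M * `|b - a|.
  apply: le_trans (lipschitz_of_derive_bound F1 F2 M dF1 bM _ _) _.
  exact: ler_wpM2l.
have h4 : `|F1 c3|^-1 <= 1.
  by rewrite invf_le1 ?(lt_trans lambda_gt0)// ltW// (lt_trans lambda_gt1).
have h5 : `|A b - A a| <= CA * `|a - b| `^ g by rewrite [`|a - b|]distrC.
have h34 : `|F1 b - F1 c3| * `|F1 c3|^-1 <= M * `|b - a|.
  by rewrite -[leRHS]mulr1; apply: ler_pM.
have ba_gt0 : 0 < `|b - a| by rewrite normr_gt0.
apply: (@le_trans _ _ (M * `|b - a| * (CA * `|a - b| `^ g / `|b - a|))).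
  by apply: ler_pM => //; apply: ler_wpM2r.
apply: ler_of_eq; field.
by rewrite gt_eqF.
Qed.

(** By the mean value theorem the two distances are multiplied by values of the
    Lipschitz function [F1], which is at least 1 in absolute value, at points at
    most [3 * rho] apart. *)
Lemma F_distortion : exists2 K, 0 <= K & forall rho a b c d : R,
  `|a - b| <= rho -> `|a - c| <= rho -> `|c - d| <= rho ->
  `|F a - F b| * `|c - d| <= (1 + K * rho) * (`|a - b| * `|F c - F d|).
Proof.
have [M M0 [bM _]] := F2_bholder.
exists (3 * M); first by rewrite mulr_ge0.
move=> rho a b c d ab ac cd.
have rho0 : 0 <= rho by apply: le_trans ab.
have [x /between_dist[_ xa] ->] := mean_value F F1 b a dF.
have [y /between_dist[_ yc] ->] := mean_value F F1 d c dF.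
have xy : `|x - y| <= 3 * rho.
  have -> : x - y = - (a - x) + (a - c) + (c - y) by ring.
  apply: le_trans (ler_normD _ _) _; apply: le_trans (lerD (ler_normD _ _) (lexx _)) _.
  by rewrite normrN; lra.
have Fxy : `|F1 x| <= (1 + 3 * M * rho) * `|F1 y|.
  have h1 : `|F1 x| <= `|F1 y| + M * (3 * rho).
    have -> : F1 x = F1 y + (F1 x - F1 y) by ring.
    apply: le_trans (ler_normD _ _) _; apply: lerD => //.
    apply: le_trans (lipschitz_of_derive_bound F1 F2 M dF1 bM _ _) _.
    exact: ler_wpM2l.
  apply: le_trans h1 _; rewrite [leRHS]mulrDl mul1r; apply: lerD => //.
  have -> : M * (3 * rho) = 3 * M * rho by ring.
  by rewrite ler_peMr ?mulr_ge0// ltW// (lt_trans lambda_gt1).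
rewrite !normrM.
have := ler_wpM2r (mulr_ge0 (normr_ge0 (a - b)) (normr_ge0 (c - d))) Fxy.
by congr (_ <= _); ring.
Qed.

Lemma Phi_shift t k : k \is a Num.int -> Phi (t + k) = Phi t.
Proof. by move=> ki; rewrite /Phi V1_shift// F2_shift// F1_shift// A_shift. Qed.

Lemma Phi_bholder (g : R) : 0 < g -> g <= e -> bholder g A -> bholder g Phi.
Proof.
move=> g0 ge Ab.
have g1 : g <= 1 by apply: le_trans ge _; exact: ltW.
apply: bholderN; apply: (@bholderM _ g (fun t => V1 t + A t * F2 t) (fun t => (F1 t)^-1)).
- exact: ltW.
- apply: bholderD; first exact: bholder_weaken V1_bholder.
  by apply: bholderM => //; [exact: ltW | exact: bholder_weaken F2_bholder].
apply: bholderV; first by move=> t; rewrite ltW// (lt_trans lambda_gt1).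
exact: bholder_weaken F1_bholder.
Qed.

Theorem line_dichotomy :
  (forall y x p k, derivable A y 1 -> k \is a Num.int -> iter p F x = x + k ->
     birkhoff R F Phi p x = 0) /\
  ((forall n x k, k \is a Num.int -> iter n F x = x + k -> birkhoff R F Phi n x = 0) ->
   forall t, derivable A t 1).
Proof.
have [G FK GK] := F_inverse.
have [L0 L00 [bL0 _]] := F1_bholder.
(* A bound of [F1] that exceeds [lambda], for small_exponent. *)
pose Lam := L0 + lambda.
have Lam_gt : lambda < Lam.
  by rewrite ltrDr; apply: lt_le_trans (bL0 0); apply: lt_trans (F1_large 0).
have Lam0 : 0 < Lam by apply: lt_trans Lam_gt.
have bL t : `|F1 t| <= Lam by apply: le_trans (bL0 t) _; rewrite lerDl ltW.
have [g [g0 ge gq]] := small_exponent Lam Lam_gt.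
have g1 : g <= 1 by apply: le_trans ge _; exact: ltW.
have Ab := A_bholder g Lam g0 g1 gq (ltW Lam0) bL.
have [B bA] := A_bounded.
have [C1 C10 hC1] := slope_step g g0 ge Ab.
have [Cp Cp0 [_ hCp]] := Phi_bholder g g0 ge Ab.
have [K K0 hK] := F_distortion.
split.
  exact: (periodic_sum_eq0 R lambda g K C1 F G A Phi lambda_gt1 g0 K0 C10 FK GK
    F_expand hK F_shift A_shift Phi_shift hC1).
move=> per0 t.
apply: (derivable_of_periodic_sums R lambda Lam g K B C1 Cp F G A Phi) => //.
- exact: F_expand.
- exact: (lipschitz_of_derive_bound F F1 Lam dF bL).
- exact: inverse_between.
- exact: A_shift.
Qed.

End Line.

(** * The circle *)

Lemma circle_reprP (R : realType) (t : R) :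
  exists2 k, k \is a Num.int & circle_repr (circle_proj t) = t + k.
Proof.
exists (circle_repr (circle_proj t) - t); last by rewrite addrC subrK.
by apply/circle_projP; rewrite circle_reprK.
Qed.

Lemma circle_projD (R : realType) (t k : R) :
  k \is a Num.int -> circle_proj (t + k) = circle_proj t.
Proof. by move=> ki; apply/circle_projP; rewrite addrAC subrr add0r. Qed.

Lemma iter_lift (R : realType) (f : circle R -> circle R) (F : R -> R) :
  is_lift f F -> forall n, is_lift (iter n f) (iter n F).
Proof. by move=> Ff; elim=> [//|n IH] t /=; rewrite Ff IH. Qed.

(** The two values are lifts of the same point of the circle. *)
Lemma lift_shift (R : realType) (f : circle R -> circle R) (F : R -> R) :
  is_lift f F -> forall t k, k \is a Num.int -> F (t + k) - F t \is a Num.int.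
Proof.
by move=> Ff t k ki; apply/circle_projP; rewrite !Ff circle_projD.
Qed.

Lemma is_derive_iter (R : realType) (F F1 : R -> R) :
  (forall t : R, is_derive t (1 : R) F (F1 t)) -> forall n (t : R),
  is_derive t (1 : R) (iter n F) (multiplier R F F1 n t).
Proof.
move=> dF; elim=> [|n IH] t.
  by rewrite /multiplier big_geq//; exact: is_derive_id.
have -> : iter n.+1 F = F \o iter n F by apply/funext.
rewrite /multiplier big_nat_recr//= -/(multiplier R F F1 n t) mulrC.
exact: is_derive1_comp.
Qed.

(** The minimal period divides any period; the orbit is cut into minimal cycles
    one by one. *)
Lemma periodic_orbit_sum (T : Type) (V : zmodType) (f : T -> T) (phi : T -> V) :
  (forall x p, is_period f x p -> \sum_(0 <= i < p) phi (iter i f x) = 0) ->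
  forall n x, iter n f x = x -> \sum_(0 <= i < n) phi (iter i f x) = 0.
Proof.
move=> H n; elim/ltn_ind: n => n IH x nx.
have [->|n0] := posnP n; first by rewrite big_geq.
have ex : exists p, (0 < p)%N && `[< iter p f x = x >].
  by exists n; rewrite n0; apply/asboolP.
case: (ex_minnP ex) => p /andP[p0 /asboolP px] pmin.
have per : is_period f x p.
  split=> // q /andP[q0 qp] qx; have := pmin q; rewrite q0 /= leqNgt qp.
  by move=> /(_ (introT (asboolP _) qx)).
have pn : (p <= n)%N by apply: pmin; rewrite n0; apply/asboolP.
have nE : iter n f x = iter (n - p) f (iter p f x) by rewrite -iterD subnK.
rewrite (big_cat_nat (n := p))//= (H _ _ per) add0r.
rewrite -{1}[p]add0n big_addn.
under eq_bigr => i _ do rewrite iterD px.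
apply: IH; first by rewrite ltn_subrL p0 n0.
by rewrite -[in RHS]nx nE px.
Qed.

Lemma derivable_translate (R : realType) (A : R -> R) (t k : R) :
  (forall s, A (s + k) = A s) -> derivable A t 1 -> derivable A (t + k) 1.
Proof.
move=> Ak; rewrite /derivable => H.
suff -> : (fun h => h^-1 *: ((A \o shift (t + k)) h%:A - A (t + k))) =
  (fun h => h^-1 *: ((A \o shift t) h%:A - A t)) by [].
by apply/funext => h /=; rewrite Ak addrA Ak.
Qed.

Theorem corollary1p4 (R : realType) (eps : R)
    (f : circle R -> circle R) (F : R -> R) (v : circle R -> R)
    (eps_gt0 : 0 < eps) (eps_lt1 : eps < 1)
    (F_lift : is_lift f F) (F_smooth : C_holder 2 eps F)
    (F_expanding : expanding F)
    (v_smooth : C_holder 1 eps (v \o @circle_proj R)) :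
  (forall y : circle R, ~ circle_derivable (alpha f F v) y) <->
  (exists (x : circle R) (p : nat), is_period f x p /\
     \sum_(0 <= i < p) phi f F v (iter i f x) <> 0).
Proof.
case: F_smooth => F_der F2_holder; case: v_smooth => V_der V1_holder.
case: F_expanding => lambda lambda_gt1 F_exp.
pose F1 := (F^`()%classic); pose F2 := (F1^`()%classic).
pose V := v \o @circle_proj R; pose V1 := (V^`()%classic).
pose A := alpha f F v \o @circle_proj R.
have dF (t : R) : is_derive t (1 : R) F (F1 t).
  by rewrite /F1 derive1E; apply/derivableP; exact: (F_der 0%N).
have dF1 (t : R) : is_derive t (1 : R) F1 (F2 t).
  by rewrite /F2 derive1E; apply/derivableP; exact: (F_der 1%N).
have dV (t : R) : is_derive t (1 : R) V (V1 t).
  by rewrite /V1 derive1E; apply/derivableP; exact: (V_der 0%N).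
have circle_dF t : circle_derive 1 F (circle_proj t) = F1 (circle_repr (circle_proj t)) by [].
have circle_d2F t : circle_derive 2 F (circle_proj t) = F2 (circle_repr (circle_proj t)) by [].
have circle_dV t : circle_derive 1 V (circle_proj t) = V1 (circle_repr (circle_proj t)) by [].
have circle_dFn n t : circle_derive 1 (iter n F) (circle_proj t)
    = multiplier R F F1 n (circle_repr (circle_proj t)).
  rewrite /circle_derive derive1n1 derive1E.
  by have dFn := is_derive_iter R F F1 dF n (circle_repr (circle_proj t)); rewrite derive_val.
have {}F2_holder : exists C, forall s t, `|F2 s - F2 t| <= C * `|s - t| `^ eps by [].
have {}V1_holder : exists C, forall s t, `|V1 s - V1 t| <= C * `|s - t| `^ eps by [].
have Fsh := lift_shift _ _ _ F_lift.
have Vsh t k : k \is a Num.int -> V (t + k) = V t.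
  by move=> ki; rewrite /V /= circle_projD.
(* From here on, only the differential relations between [F], [F1], [F2] and
   between [V], [V1] are used. *)
move: circle_dV circle_dFn circle_dF circle_d2F dF dF1 dV F2_holder V1_holder.
move: F1 F2 V1 => F1 F2 V1.
move=> circle_dV circle_dFn circle_dF circle_d2F dF dF1 dV F2_holder V1_holder.
have F1sh := F1_shift R F F1 dF Fsh.
have F2sh := F2_shift R F F1 F2 dF dF1 Fsh.
have V1sh := V1_shift R V V1 dV Vsh.
have F1_large t : lambda < `|F1 t|.
  have := F_exp (circle_proj t); rewrite circle_dF.
  by have [k ki ->] := circle_reprP R t; rewrite F1sh.
have A_lim t : ((fun N => partial_sum R F F1 V N t) @ \oo --> - A t)%classic.
  rewrite /A /= /alpha opprK.
  have term N : \sum_(1 <= n < N.+1) v (iter n.-1 f (circle_proj t)) /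
      circle_derive 1 (iter n F) (circle_proj t) = partial_sum R F F1 V N t.
    rewrite big_add1 /=; apply: eq_bigr => i _.
    rewrite -(iter_lift _ _ _ F_lift) circle_dFn; congr (_ / _).
    have [k ki ->] := circle_reprP R t.
    apply: eq_bigr => j _.
    rewrite -[iter j F (t + k)](subrK (iter j F t)) addrC F1sh//.
    exact: (lift_shift _ _ _ (iter_lift _ _ _ F_lift j)).
  have cv := partial_sum_cvg R lambda eps F F1 V V1 eps_gt0 lambda_gt1 dV V1_holder Vsh F1_large t.
  suff -> : limn (fun N => \sum_(1 <= n < N) v (iter n.-1 f (circle_proj t)) /
      circle_derive 1 (iter n F) (circle_proj t)) = limn (fun N => partial_sum R F F1 V N t) by [].
  (* The sum from 1 to [N] excluded has one term less than [partial_sum N]. *)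
  apply: cvg_lim => //; rewrite -cvg_shiftS /=.
  by under eq_fun do rewrite term.
have [dichI dichII] := line_dichotomy R lambda eps F F1 F2 V V1 A eps_gt0 eps_lt1 lambda_gt1
  dF dF1 dV F2_holder V1_holder Fsh Vsh F1_large A_lim.
have phiE t : phi f F v (circle_proj t) = Phi R F1 F2 V1 A t.
  rewrite /phi circle_dF circle_d2F circle_dV.
  by have [k ki ->] := circle_reprP R t; rewrite F1sh// F2sh// V1sh.
have sumE p t : \sum_(0 <= i < p) phi f F v (iter i f (circle_proj t))
    = birkhoff R F (Phi R F1 F2 V1 A) p t.
  by apply: eq_bigr => i _; rewrite -(iter_lift _ _ _ F_lift) phiE.
split.
  move=> nowhere; apply: contrapT => none.
  have per0 x p : is_period f x p -> \sum_(0 <= i < p) phi f F v (iter i f x) = 0.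
    by move=> per; apply: contrapT => ne; apply: none; exists x, p.
  have At : derivable A (0 : R) 1.
    apply: dichII => n x k ki xk; rewrite -sumE.
    apply: (periodic_orbit_sum _ _ _ _ per0).
    by rewrite -(iter_lift _ _ _ F_lift) xk circle_projD.
  apply: (nowhere (circle_proj 0)); rewrite /circle_derivable -/A.
  have [k ki ->] := circle_reprP R 0.
  by apply: derivable_translate At => s; rewrite /A /= circle_projD.
move=> [x [p [[p0 px _] ne]]] y; rewrite /circle_derivable -/A => Ay; apply: ne.
have xp : circle_proj (iter p F (circle_repr x)) = circle_proj (circle_repr x).
  by rewrite (iter_lift _ _ _ F_lift) circle_reprK.
rewrite -[x]circle_reprK sumE.
apply: (dichI _ _ _ (iter p F (circle_repr x) - circle_repr x) Ay).
  exact/circle_projP.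
by rewrite addrC subrK.
Qed.
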